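(* Let $a\in\mathbb{H}\setminus\{0\}$ and $\rho>0$. If $r>\max\{|a|,\rho^{2}|a|^{-1}\}$, then $$\frac{1}{|\partial \mathbb{B}_{r}|}\int_{\partial \mathbb{B}_{r}}\log|B_{a,\rho}^p(y)|\,d\sigma(y)=\log\frac{|a|}{\rho}+\frac{1}{4}\left(\frac{\rho^{4}-|a|^{4}}{|a|^{2}r^{2}}\right),$$ $$\frac{1}{|\partial \mathbb{B}_{r}|}\int_{\partial \mathbb{B}_{r}}\log|B_{\mathbb{S}_{a},\rho}(y)|\,d\sigma(y)=2\log\frac{|a|}{\rho}-\frac{1}{4}\left(\frac{\rho^{4}-|a|^{4}}{|a|^{4}r^{2}}\right)\left(2|a|^{2}-(a+ a^{c})^{2}\right).$$
   Context: $\mathbb{H}$ denotes the quaternions, identified with $\mathbb{R}^4$, $x^c$ is the usual conjugate and $|x|^2=xx^c$; $\mathbb{B}_r=\{|x|<r\}$, $d\sigma$ is the 3-dimensional surface measure on $\partial\mathbb{B}_r$ and $|\partial\mathbb{B}_r|$ its total mass. The punctual $\rho$-Blaschke factor at $a$ is $B^p_{a,\rho}(x)=(\rho^2-xa^c)(\rho(x-a))^{-1}$ (pointwise product). For $q\in\mathbb{H}$ put $(x-q)^s=x^2-x(q+q^c)+qq^c$. The $\rho$-Blaschke factor at the sphere $\mathbb{S}_a=\{\mathrm{Re}(a)+J|\mathrm{Im}(a)|: J^2=-1\}$ is $B_{\mathbb{S}_a,\rho}(x)=\big(\rho^2(x-a)^s\big)^{-1}(x-\rho^2a^{-1})^s|a|^2$.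 Here these formulas are taken as definitions for every $a\ne0$ and $\rho>0$. *)

(* Defs.v *)
From HB Require Import structures.
From mathcomp Require Import all_boot all_order all_algebra.
From mathcomp Require Import ring lra.
From mathcomp Require Import all_classical all_reals all_analysis.
From mathcomp Require Import measurable_realfun.

Set Implicit Arguments.
Unset Strict Implicit.
Unset Printing Implicit Defensive.

Import Order.TTheory GRing.Theory Num.Theory.
Import numFieldNormedType.Exports.

Local Open Scope classical_set_scope.
Local Open Scope ring_scope.

Record quat (R : Type) : Type := Quat { q0 : R; q1 : R; q2 : R; q3 : R }.

Section quat_carrier.
Context {R : realType}.
Implicit Types x y z : quat R.

Definition quat_coords x : R * R * R * R := (q0 x, q1 x, q2 x, q3 x).
Definition quat_of_coords (v : R * R * R * R) : quat R :=
  Quat v.1.1.1 v.1.1.2 v.1.2 v.2.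

Lemma quat_coordsK : cancel quat_coords quat_of_coords.
Proof. by case. Qed.

Lemma quatP x y :
  q0 x = q0 y -> q1 x = q1 y -> q2 x = q2 y -> q3 x = q3 y -> x = y.
Proof. by case: x => ? ? ? ?; case: y => ? ? ? ? /= -> -> -> ->. Qed.

HB.instance Definition _ := Choice.copy (quat R) (can_type quat_coordsK).
HB.instance Definition _ := isPointed.Build (quat R) (Quat 0 0 0 0).

Definition quat_add x y :=
  Quat (q0 x + q0 y) (q1 x + q1 y) (q2 x + q2 y) (q3 x + q3 y).
Definition quat_opp x := Quat (- q0 x) (- q1 x) (- q2 x) (- q3 x).

Let quat_addA : associative quat_add.
Proof. by move=> x y z; apply: quatP => /=; rewrite addrA. Qed.
Let quat_addC : commutative quat_add.
Proof. by move=> x y; apply: quatP => /=; rewrite addrC. Qed.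
Let quat_add0 : left_id (Quat 0 0 0 0) quat_add.
Proof. by move=> x; apply: quatP => /=; rewrite add0r. Qed.
Let quat_addN : left_inverse (Quat 0 0 0 0) quat_opp quat_add.
Proof. by move=> x; apply: quatP => /=; rewrite addNr. Qed.

HB.instance Definition _ := GRing.isZmodule.Build (quat R)
  quat_addA quat_addC quat_add0 quat_addN.

Definition quat_mul x y := Quat
  (q0 x * q0 y - q1 x * q1 y - q2 x * q2 y - q3 x * q3 y)
  (q0 x * q1 y + q1 x * q0 y + q2 x * q3 y - q3 x * q2 y)
  (q0 x * q2 y - q1 x * q3 y + q2 x * q0 y + q3 x * q1 y)
  (q0 x * q3 y + q1 x * q2 y - q2 x * q1 y + q3 x * q0 y).

Let quat_mulA : associative quat_mul.
Proof. by move=> x y z; apply: quatP => /=; ring. Qed.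
Let quat_mul1q : left_id (Quat 1 0 0 0) quat_mul.
Proof. by move=> x; apply: quatP => /=; ring. Qed.
Let quat_mulq1 : right_id (Quat 1 0 0 0) quat_mul.
Proof. by move=> x; apply: quatP => /=; ring. Qed.
Let quat_mulDl : left_distributive quat_mul quat_add.
Proof. by move=> x y z; apply: quatP => /=; ring. Qed.
Let quat_mulDr : right_distributive quat_mul quat_add.
Proof. by move=> x y z; apply: quatP => /=; ring. Qed.
Let quat_1neq0 : Quat 1 0 0 0 != 0 :> quat R.
Proof. by apply/eqP => -[] /eqP; rewrite oner_eq0. Qed.

HB.instance Definition _ := GRing.Zmodule_isNzRing.Build (quat R)
  quat_mulA quat_mul1q quat_mulq1 quat_mulDl quat_mulDr quat_1neq0.

Definition quat_sqn x : R := q0 x ^+ 2 + q1 x ^+ 2 + q2 x ^+ 2 + q3 x ^+ 2.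

Lemma quat_sqn_eq0 x : (quat_sqn x == 0) = (x == 0).
Proof.
apply/eqP/eqP => [h|->]; last by rewrite /quat_sqn /= !expr0n /= !addr0.
have [h0 h1 h2 h3] : [/\ q0 x ^+ 2 = 0, q1 x ^+ 2 = 0, q2 x ^+ 2 = 0
    & q3 x ^+ 2 = 0].
  have := sqr_ge0 (q0 x); have := sqr_ge0 (q1 x).
  have := sqr_ge0 (q2 x); have := sqr_ge0 (q3 x).
  by move: h; rewrite /quat_sqn => *; split; lra.
by apply: quatP => /=; apply/eqP; rewrite -sqrf_eq0 ?h0 ?h1 ?h2 ?h3.
Qed.

Definition quat_inv x := Quat (q0 x / quat_sqn x) (- q1 x / quat_sqn x)
  (- q2 x / quat_sqn x) (- q3 x / quat_sqn x).

Let quat_mulVq : {in [pred x | x != 0], left_inverse 1 quat_inv *%R}.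
Proof.
move=> x; rewrite inE -quat_sqn_eq0 => x0.
by apply: quatP => /=; rewrite ?[1 in RHS]/=; move: x0;
  rewrite /quat_sqn => x0; field.
Qed.
Let quat_mulqV : {in [pred x | x != 0], right_inverse 1 quat_inv *%R}.
Proof.
move=> x; rewrite inE -quat_sqn_eq0 => x0.
by apply: quatP => /=; move: x0; rewrite /quat_sqn => x0; field.
Qed.
Let quat_unitP x y : y * x = 1 /\ x * y = 1 -> x != 0.
Proof.
move=> [yx _]; apply/eqP => x0; move: yx; rewrite x0 mulr0 => /esym/eqP.
by rewrite oner_eq0.
Qed.
Let quat_inv0 : {in [predC [pred x | x != 0]], quat_inv =1 id}.
Proof.
move=> x; rewrite !inE negbK => /eqP ->.
by apply: quatP => /=; rewrite ?oppr0 mul0r.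
Qed.

HB.instance Definition _ := GRing.NzRing_hasMulInverse.Build (quat R)
  quat_mulVq quat_mulqV quat_unitP quat_inv0.

Definition quat_real (t : R) : quat R := Quat t 0 0 0.
Definition qconj x := Quat (q0 x) (- q1 x) (- q2 x) (- q3 x).

(* |x|^2 = x x^c, a real quaternion *)
Definition quat_abs x : R := Num.sqrt (q0 (x * qconj x)).

Lemma quat_mulcj x : x * qconj x = quat_real (quat_abs x ^+ 2).
Proof.
have e : q0 (x * qconj x) = quat_sqn x by rewrite /= /quat_sqn; ring.
rewrite /quat_abs e sqr_sqrtr; last by rewrite !addr_ge0// sqr_ge0.
by apply: quatP => //=; ring.
Qed.

(* the Borel sigma-algebra of R^4, transported along quat_of_coords *)
Definition quat_measurable : set (set (quat R)) :=
  [set A | measurable (quat_of_coords @^-1` A)].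

Let quat_measurable0 : quat_measurable set0.
Proof. by rewrite /quat_measurable /= preimage_set0. Qed.
Let quat_measurableC A : quat_measurable A -> quat_measurable (~` A).
Proof. by rewrite /quat_measurable /= preimage_setC; exact: measurableC. Qed.
Let quat_measurable_bigcup (F : (set (quat R))^nat) :
  (forall i, quat_measurable (F i)) -> quat_measurable (\bigcup_i F i).
Proof.
rewrite /quat_measurable /= => mF; rewrite preimage_bigcup.
exact: bigcup_measurable.
Qed.

HB.instance Definition _ := isMeasurable.Build default_measure_display
  (quat R) quat_measurable0 quat_measurableC quat_measurable_bigcup.

End quat_carrier.

Notation "t %:H" := (quat_real t)
  (at level 1, left associativity, format "t %:H") : ring_scope.

Section blaschke.
Context {R : realType}.
Implicit Types (x q a : quat R) (rho : R).

(* (x - q)^s, as a function of x *)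
Definition sphere_poly q x : quat R := x ^+ 2 - x * (q + qconj q) + q * qconj q.

Definition blaschke_point a rho x : quat R :=
  ((rho ^+ 2)%:H - x * qconj a) * (rho%:H * (x - a))^-1.

Definition blaschke_sphere a rho x : quat R :=
  ((rho ^+ 2)%:H * sphere_poly a x)^-1 *
  sphere_poly ((rho ^+ 2)%:H * a^-1) x * (quat_abs a ^+ 2)%:H.

End blaschke.

Section surface_measure.
Context {R : realType}.
Implicit Types (r : R) (u : R * R * R).
Local Notation mu := (@lebesgue_measure R).

Definition quat_sphere r : set (quat R) := [set x | quat_abs x = r].

(* Hyperspherical coordinates: this maps sphere_box onto the sphere of radius
   r > 0 of R^4, and is injective on the interior of sphere_box, whose image
   is the sphere up to a lower-dimensional set. *)
Definition sphere_param r u : quat R := Quat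
  (r * cos u.1.1)
  (r * (sin u.1.1 * cos u.1.2))
  (r * (sin u.1.1 * sin u.1.2 * cos u.2))
  (r * (sin u.1.1 * sin u.1.2 * sin u.2)).

Definition sphere_box : set (R * R * R) :=
  `[0, pi] `*` `[0, pi] `*` `[0, 2 * pi].

Definition quat_dot (x y : quat R) : R :=
  q0 x * q0 y + q1 x * q1 y + q2 x * q2 y + q3 x * q3 y.

(* velocity of a curve in H = R^4 *)
Definition quat_derive (c : R -> quat R) (t : R) : quat R := Quat
  (derive1 (fun s => q0 (c s)) t) (derive1 (fun s => q1 (c s)) t)
  (derive1 (fun s => q2 (c s)) t) (derive1 (fun s => q3 (c s)) t).

Definition sphere_tangent r u : 3.-tuple (quat R) := [tuple
  quat_derive (fun t => sphere_param r (t, u.1.2, u.2)) u.1.1;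
  quat_derive (fun t => sphere_param r (u.1.1, t, u.2)) u.1.2;
  quat_derive (fun t => sphere_param r (u.1.1, u.1.2, t)) u.2].

Definition sphere_area_density r u : R :=
  Num.sqrt (\det (\matrix_(i < 3, j < 3)
    quat_dot (tnth (sphere_tangent r u) i) (tnth (sphere_tangent r u) j))).

(* 3-dimensional surface measure on the sphere of radius r: the area element
   of the parametrization is the square root of its Gram determinant. *)
Definition sphere_measure r (A : set (quat R)) : \bar R :=
  (\int[(mu \x mu) \x mu]_(u in sphere_box `&` (sphere_param r @^-1` A))
     (sphere_area_density r u)%:E)%E.

Lemma sphere_tangentE r u : sphere_tangent r u = [tuple
  Quat (- (r * sin u.1.1)) (r * (cos u.1.1 * cos u.1.2))
    (r * (cos u.1.1 * sin u.1.2 * cos u.2))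
    (r * (cos u.1.1 * sin u.1.2 * sin u.2));
  Quat 0 (- (r * (sin u.1.1 * sin u.1.2)))
    (r * (sin u.1.1 * cos u.1.2 * cos u.2))
    (r * (sin u.1.1 * cos u.1.2 * sin u.2));
  Quat 0 0 (- (r * (sin u.1.1 * sin u.1.2 * sin u.2)))
    (r * (sin u.1.1 * sin u.1.2 * cos u.2))].
Proof.
have dl (k l t df : R) (f : R -> R) : is_derive t 1 f df ->
    derive1 (fun s => k * (f s * l)) t = k * (df * l).
  move=> fd; rewrite derive1E.
  have -> : (fun s => k * (f s * l)) = (k * l) *: f.
    by apply/funext => s; rewrite !fctE /= [RHS]mulrAC mulrA.
  by rewrite derive_val /GRing.scale /= mulrAC mulrA.
have dcos (k l t : R) : derive1 (fun s => k * (cos s * l)) t =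
    k * (- sin t * l) by exact: dl.
have dsin (k l t : R) : derive1 (fun s => k * (sin s * l)) t =
    k * (cos t * l) by exact: dl.
have dc (k t : R) : derive1 (fun=> k : R) t = 0.
  by rewrite derive1E derive_val.
have ext (f g : R -> R) t : f =1 g -> derive1 f t = derive1 g t.
  by move=> /funext ->.
rewrite /sphere_tangent /quat_derive /=.
apply/val_inj => /=; congr [:: _; _; _]; apply: quatP => /=; rewrite ?dc//.
- rewrite (ext _ (fun s => r * (cos s * 1))); last by move=> s; rewrite mulr1.
  by rewrite dcos; ring.
- rewrite (ext _ (fun s => r * (sin s * (sin u.1.2 * cos u.2)))); last first.
    by move=> s; ring.
  by rewrite dsin; ring.
- rewrite (ext _ (fun s => r * (sin s * (sin u.1.2 * sin u.2)))); last first.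
    by move=> s; ring.
  by rewrite dsin; ring.
- rewrite (ext _ (fun s => r * (cos s * sin u.1.1))); last by move=> s; ring.
  by rewrite dcos; ring.
- rewrite (ext _ (fun s => r * (sin s * (sin u.1.1 * cos u.2)))); last first.
    by move=> s; ring.
  by rewrite dsin; ring.
- rewrite (ext _ (fun s => r * (sin s * (sin u.1.1 * sin u.2)))); last first.
    by move=> s; ring.
  by rewrite dsin; ring.
- rewrite (ext _ (fun s => r * (cos s * (sin u.1.1 * sin u.1.2)))); last first.
    by move=> s; ring.
  by rewrite dcos; ring.
- rewrite (ext _ (fun s => r * (sin s * (sin u.1.1 * sin u.1.2)))); last first.
    by move=> s; ring.
  by rewrite dsin; ring.
Qed.

Lemma sphere_area_densityE r u :
  sphere_area_density r u = `|r ^+ 3 * (sin u.1.1 ^+ 2 * sin u.1.2)|.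
Proof.
rewrite -sqrtr_sqr /sphere_area_density; congr Num.sqrt.
pose e t : R := cos t ^+ 2 + sin t ^+ 2 - 1.
have e0 t : e t = 0 by rewrite /e cos2Dsin2 subrr.
have lc (k1 k2 k3 x y : R) :
    x = y + (k1 * e u.1.1 + k2 * e u.1.2 + k3 * e u.2) -> x = y.
  by rewrite !e0 !mulr0 !addr0.
set A := (X in \det X).
have -> : A = diag_mx (\row_j nth 0 [:: r ^+ 2; r ^+ 2 * sin u.1.1 ^+ 2;
    r ^+ 2 * sin u.1.1 ^+ 2 * sin u.1.2 ^+ 2] j).
  apply/matrixP => i j; rewrite !mxE sphere_tangentE /quat_dot.
  case: i => -[|[|[|//]]] i; case: j => -[|[|[|//]]] j;
    rewrite !(tnth_nth 0) /= ?mulr1n ?mulr0n.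
  - apply: (lc (r ^+ 2) (r ^+ 2 * cos u.1.1 ^+ 2)
      (r ^+ 2 * cos u.1.1 ^+ 2 * sin u.1.2 ^+ 2)); rewrite /e; ring.
  - apply: (lc 0 0 (r ^+ 2 * cos u.1.1 * cos u.1.2 * sin u.1.1 * sin u.1.2)).
    rewrite /e; ring.
  - by ring.
  - apply: (lc 0 0 (r ^+ 2 * cos u.1.1 * cos u.1.2 * sin u.1.1 * sin u.1.2)).
    rewrite /e; ring.
  - apply: (lc 0 (r ^+ 2 * sin u.1.1 ^+ 2)
      (r ^+ 2 * sin u.1.1 ^+ 2 * cos u.1.2 ^+ 2)); rewrite /e; ring.
  - by ring.
  - by ring.
  - by ring.
  - apply: (lc 0 0 (r ^+ 2 * sin u.1.1 ^+ 2 * sin u.1.2 ^+ 2)).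
    rewrite /e; ring.
rewrite det_diag !big_ord_recl big_ord0 !mxE /=; ring.
Qed.

Let m1 : measurable_fun setT (fun u => u.1.1).
Proof. exact: (measurableT_comp measurable_fst measurable_fst). Qed.
Let m2 : measurable_fun setT (fun u => u.1.2).
Proof. exact: (measurableT_comp measurable_snd measurable_fst). Qed.
Let m3 : measurable_fun setT (fun u => u.2).
Proof. exact: measurable_snd. Qed.
Let msin (p : R * R * R -> R) :
  measurable_fun setT p -> measurable_fun setT (fun u => sin (p u)).
Proof.
move=> mp; apply: (measurableT_comp _ mp).
apply: continuous_measurable_fun => x.
exact: continuous_sin.
Qed.
Let mcos (p : R * R * R -> R) :
  measurable_fun setT p -> measurable_fun setT (fun u => cos (p u)).
Proof.
move=> mp; apply: (measurableT_comp _ mp).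
apply: continuous_measurable_fun => x.
exact: continuous_cos.
Qed.

Lemma measurable_sphere_area_density r :
  measurable_fun setT (sphere_area_density r).
Proof.
rewrite (_ : sphere_area_density r =
  fun u => `|r ^+ 3 * (sin u.1.1 ^+ 2 * sin u.1.2)|); last first.
  by apply/funext => u; rewrite sphere_area_densityE.
apply: measurableT_comp => //; apply: measurable_funM => //.
by apply: measurable_funM; [apply: measurable_funX|]; exact: msin.
Qed.

Lemma measurable_sphere_param r : measurable_fun setT (sphere_param r).
Proof.
have mc : measurable_fun setT (@quat_coords R \o sphere_param r).
  have mr (p : R * R * R -> R) :
      measurable_fun setT p -> measurable_fun setT (fun u => r * p u).
    exact: measurable_funM.
  rewrite /comp /quat_coords /=.
  apply: measurable_fun_pair;
    [apply: measurable_fun_pair; [apply: measurable_fun_pair|]|];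
    apply: mr; do ?[apply: measurable_funM]; exact: msin || exact: mcos.
move=> _ A mA; rewrite setTI; have := mc measurableT _ mA.
by rewrite setTI.
Qed.

Lemma measurable_sphere_box : measurable sphere_box.
Proof. by do 2 apply: measurableX => //. Qed.

Let sphere_measure0 r : sphere_measure r set0 = 0%E.
Proof. by rewrite /sphere_measure preimage_set0 setI0 integral_set0. Qed.
Let sphere_measure_ge0 r A : (0 <= sphere_measure r A)%E.
Proof. by apply: integral_ge0 => u _; rewrite lee_fin sqrtr_ge0. Qed.
Let sphere_measure_sigma_additive r : semi_sigma_additive (sphere_measure r).
Proof.
move=> F mF tF mUF; rewrite /sphere_measure preimage_bigcup setI_bigcupr.
rewrite ge0_integral_bigcup//=.
- apply: is_cvg_ereal_nneg_natsum_cond => n _ _.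
  exact: sphere_measure_ge0.
- move=> k; apply: measurableI; first exact: measurable_sphere_box.
  by rewrite -[X in measurable X]setTI; exact: measurable_sphere_param.
- apply/measurable_funTS/measurable_EFinP.
  exact: measurable_sphere_area_density.
- by move=> u _; rewrite lee_fin sqrtr_ge0.
- apply/trivIsetP => i j _ _ ij; rewrite setIACA -preimage_setI.
  by move/trivIsetP : tF => /(_ _ _ _ _ ij) -> //; rewrite preimage_set0 setI0.
Qed.

HB.instance Definition _ r := isMeasure.Build _ _ _ (sphere_measure r)
  (sphere_measure0 r) (sphere_measure_ge0 r)
  (@sphere_measure_sigma_additive r).

End surface_measure.

(* Main.v *)
(* On the sphere of radius r, |y - b| and |(y - q)^s| are, up to powers of r,
   products of squared distances 1 + s^2 - 2 s x from s to the unit circle, with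
   s = |b| / r < 1 and s = |q| / r < 1. Their logarithms expand uniformly as
   - 2 sum_n s^n T_n(x) / n in the Chebyshev polynomials, so it suffices to
   integrate T_n over the sphere. If x is the first angle's cosine this is an
   elementary integral in which only n = 0 and n = 2 survive. If x = <y, e> for
   a unit vector e, integrating the divergence of the gradient of <y, e>^(m+1)
   over the unit sphere gives the recursion
     (m + 3) int <y, e>^(m+1) = m int <y, e>^(m-1);
   hence the moments, and so the integral of T_n(<y, e>), do not depend on e,
   which replaces rotation invariance of the surface measure. *)
From HB Require Import structures.
Require Import Defs.
From mathcomp Require Import all_boot all_order all_algebra.
From mathcomp Require Import ring lra.
From mathcomp Require Import all_classical all_reals all_analysis.
From mathcomp Require Import measurable_realfun.

Set Implicit Arguments.
Unset Strict Implicit.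
Unset Printing Implicit Defensive.

Import Order.TTheory GRing.Theory Num.Theory.
Import numFieldNormedType.Exports.
Local Open Scope classical_set_scope.
Local Open Scope ring_scope.

Section pointwise_derivation_rules.
Context {R : realType}.
Implicit Types (f g : R -> R) (x a b k : R).

Lemma is_derive1_add f g x a b : is_derive x 1 f a -> is_derive x 1 g b ->
  is_derive x 1 (fun y => f y + g y) (a + b).
Proof. by move=> df dg; exact: is_deriveD. Qed.

Lemma is_derive1_opp f x a : is_derive x 1 f a ->
  is_derive x 1 (fun y => - f y) (- a).
Proof. by move=> df; exact: is_deriveN. Qed.

Lemma is_derive1_mul f g x a b : is_derive x 1 f a -> is_derive x 1 g b ->
  is_derive x 1 (fun y => f y * g y) (a * g x + f x * b).
Proof.
move=> df dg; have := is_deriveM df dg.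
by rewrite addrC /GRing.scale /= [g x * a]mulrC.
Qed.

Lemma is_derive1_exp f n x a : is_derive x 1 f a ->
  is_derive x 1 (fun y => f y ^+ n) (n%:R * f x ^+ n.-1 * a).
Proof. by move=> df; have := is_deriveX n df; rewrite exprfctE. Qed.

Lemma is_derive1_sum n (h : 'I_n -> R -> R) x (dh : 'I_n -> R) :
  (forall i, is_derive x 1 (h i) (dh i)) ->
  is_derive x 1 (fun y => \sum_(i < n) h i y) (\sum_(i < n) dh i).
Proof. by move=> /is_derive_sum; rewrite fct_sumE. Qed.

Lemma is_derive1_fct_id x : is_derive x 1 (fun y : R => y) (1 : R).
Proof. exact: is_derive_id. Qed.

Lemma is_derive1_fct_cst x k : is_derive x 1 (fun _ : R => k) (0 : R).
Proof. exact: is_derive_cst. Qed.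

End pointwise_derivation_rules.

Ltac is_derive1_step := first
  [ exact: is_derive1_fct_cst | exact: is_derive1_fct_id | eassumption
  | exact: is_derive_sin | exact: is_derive_cos
  | notypeclasses refine (is_derive1_add _ _)
  | notypeclasses refine (is_derive1_opp _)
  | notypeclasses refine (is_derive1_mul _ _)
  | notypeclasses refine (is_derive1_exp _ _)
  | notypeclasses refine (is_derive1_sum _); intro ].

(* Leaves the equation between the computed and the stated derivative. *)
Ltac is_derive1_tac :=
  notypeclasses refine (is_derive_eq _ _); [repeat is_derive1_step|].

Section chebyshev.
Context {R : realType}.
Implicit Types (x s t : R) (n : nat).

Fixpoint chebyshev_pair n : {poly R} * {poly R} :=
  if n is m.+1 then
    let: (p, q) := chebyshev_pair m in (q, 2%:P * 'X * q - p)
  else (1, 'X).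

Definition chebyshev n : {poly R} := (chebyshev_pair n).1.

Lemma chebyshev0 : chebyshev 0 = 1. Proof. by []. Qed.

Lemma chebyshev1 : chebyshev 1 = 'X. Proof. by []. Qed.

Lemma chebyshevSS n :
  chebyshev n.+2 = 2%:P * 'X * chebyshev n.+1 - chebyshev n.
Proof. by rewrite /chebyshev /=; case: chebyshev_pair. Qed.

Lemma horner_chebyshevSS n x : (chebyshev n.+2).[x] =
  2 * x * (chebyshev n.+1).[x] - (chebyshev n).[x].
Proof. by rewrite chebyshevSS !hornerE. Qed.

Lemma horner_chebyshev_cos n t : (chebyshev n).[cos t] = cos (n%:R * t).
Proof.
suff : (chebyshev n).[cos t] = cos (n%:R * t) /\
  (chebyshev n.+1).[cos t] = cos (n.+1%:R * t) by case.
elim: n => [|n [IH1 IH2]].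
  by rewrite chebyshev0 chebyshev1 !hornerE ?mul0r ?cos0 ?mul1r.
split=> //; rewrite horner_chebyshevSS IH1 IH2.
have -> : n.+2%:R * t = n.+1%:R * t + t by rewrite -[in LHS]natr1; ring.
have -> : n%:R * t = n.+1%:R * t - t by rewrite -natr1; ring.
by rewrite cosB cosD; ring.
Qed.

Lemma normr_chebyshev_le1 n x : `|x| <= 1 -> `|(chebyshev n).[x]| <= 1.
Proof.
move=> /ler_normlP [x1 x2]; rewrite -[x]acosK ?horner_chebyshev_cos.
  by rewrite ler_norml cos_geN1 cos_le1.
by rewrite in_itv/=; apply/andP; split; lra.
Qed.

(* The squared distance from s to the unit circle's points of abscissa x. *)
Definition sqdist_circle s x := 1 + s ^+ 2 - 2 * s * x.

Lemma sqdist_circle_ge s x : 0 <= s -> `|x| <= 1 ->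
  (1 - s) ^+ 2 <= sqdist_circle s x.
Proof.
move=> s0 /ler_normlP [x1 x2]; rewrite /sqdist_circle.
have : 0 <= s * (1 - x) by apply: mulr_ge0; lra.
by nra.
Qed.

Lemma sqdist_circle_gt0 s x : 0 <= s < 1 -> `|x| <= 1 -> 0 < sqdist_circle s x.
Proof.
move=> /andP[s0 s1] x1; apply: lt_le_trans _ (sqdist_circle_ge s0 x1).
by rewrite exprn_gt0// subr_gt0.
Qed.

(* The left-hand side is sqdist_circle s x times the derivative in s of
   ln (sqdist_circle s x) - ln_sqdist_sum N s x. *)
Lemma chebyshev_geometric N s x :
  2 * s - 2 * x + sqdist_circle s x *
     (2 * \sum_(i < N) s ^+ i * (chebyshev i.+1).[x]) =
  2 * s ^+ N.+1 * (chebyshev N).[x] - 2 * s ^+ N * (chebyshev N.+1).[x].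
Proof.
elim: N => [|N IH].
  by rewrite big_ord0 chebyshev0 chebyshev1 !hornerE /sqdist_circle /=; ring.
rewrite big_ord_recr /= horner_chebyshevSS.
have -> : forall a b d : R, 2 * s - 2 * x + d * (2 * (a + b)) =
  2 * s - 2 * x + d * (2 * a) + d * (2 * b) by move=> a b d; ring.
by rewrite IH /sqdist_circle !exprS; ring.
Qed.

Definition ln_sqdist_sum N s x :=
  - (2 * \sum_(i < N) s ^+ i.+1 / i.+1%:R * (chebyshev i.+1).[x]).

Lemma ln_sqdist_approx N s x : 0 <= s < 1 -> `|x| <= 1 ->
  `|ln (sqdist_circle s x) - ln_sqdist_sum N s x| <=
  4 * s ^+ N.+1 / (1 - s) ^+ 2.
Proof.
move=> /andP[s0 s1] x1.
pose df (y : R) := (2 * y - 2 * x) / sqdist_circle y x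
  + 2 * \sum_(i < N) y ^+ i * (chebyshev i.+1).[x].
pose f (y : R) := ln (sqdist_circle y x) - ln_sqdist_sum N y x.
have fd (y : R) : 0 <= y < 1 -> is_derive y 1 f (df y).
  move=> y01; rewrite /f.
  have D0 := sqdist_circle_gt0 y01 x1.
  have dD : is_derive y 1 (sqdist_circle ^~ x) (2 * y - 2 * x).
    by rewrite /sqdist_circle; is_derive1_tac; rewrite /=; ring.
  have dl : is_derive y 1 (fun y => ln (sqdist_circle y x))
      ((2 * y - 2 * x) / sqdist_circle y x).
    have dln := is_derive1_ln D0.
    rewrite [_ / _]mulrC.
    exact: (@is_derive1_comp _ (@ln R) (sqdist_circle ^~ x)).
  have dS : is_derive y 1 (fun y => ln_sqdist_sum N y x)
     (- (2 * \sum_(i < N) y ^+ i * (chebyshev i.+1).[x])).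
    rewrite /ln_sqdist_sum.
    is_derive1_tac; rewrite /= mul0r add0r; congr (- (2 * _)).
    apply: eq_bigr => i _ /=.
    rewrite !mulr0 !addr0 mulr1; congr (_ * _).
    by rewrite mulrAC mulfV ?mul1r// pnatr_eq0.
  have -> : df y = (2 * y - 2 * x) / sqdist_circle y x -
     - (2 * \sum_(i < N) y ^+ i * (chebyshev i.+1).[x]) by rewrite opprK.
  exact: is_deriveB.
have f0 : f 0 = 0.
  have -> : f 0 = ln (1 + 0 ^+ 2 - 2 * 0 * x) - ln_sqdist_sum N 0 x by [].
  rewrite /ln_sqdist_sum big1; last by move=> i _; rewrite exprS !mul0r.
  by rewrite expr0n /= !(mulr0, mul0r, oppr0, addr0) ln1.
have [|y|y ys fE] := @MVT_segment R f df 0 s s0.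
- by move=> y; rewrite in_itv/= => /andP[y0 ys]; apply: fd; lra.
- apply: continuous_in_subspaceT => z; rewrite inE/= in_itv/= => /andP[z0 zs].
  apply: differentiable_continuous; apply/derivable1_diffP.
  by case: (fd z _) => //; lra.
move: ys; rewrite in_itv/= => /andP[y0 ys].
rewrite -/(f s) -[f s]subr0 -f0 fE subr0.
have D0 : 0 < sqdist_circle y x by apply: sqdist_circle_gt0 => //; lra.
have -> : df y = (2 * y ^+ N.+1 * (chebyshev N).[x] -
    2 * y ^+ N * (chebyshev N.+1).[x]) / sqdist_circle y x.
  rewrite -chebyshev_geometric /df; field; exact: lt0r_neq0.
rewrite normrM (ger0_norm s0) normrM normfV (gtr0_norm D0).
have -> : 4 * s ^+ N.+1 / (1 - s) ^+ 2 = 4 * s ^+ N / (1 - s) ^+ 2 * s.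
  by rewrite exprS; ring.
apply: ler_wpM2r => //; apply: ler_pM => //.
- by rewrite invr_ge0 ltW.
- apply: (@le_trans _ _ (4 * y ^+ N)); last by rewrite ler_wpM2l ?lerXn2r.
  have yN : 0 <= y ^+ N by exact: exprn_ge0.
  have c1 := normr_chebyshev_le1 N x1; have c2 := normr_chebyshev_le1 N.+1 x1.
  apply: le_trans (ler_normB _ _) _.
  rewrite !normrM !normrX (ger0_norm y0) (ger0_norm (_ : 0 <= 2 :> R))// exprS.
  have : y * y ^+ N * `|(chebyshev N).[x]| <= y ^+ N.
    rewrite mulrAC; apply: ler_piMl => //; apply: mulr_ile1 => //; lra.
  have : y ^+ N * `|(chebyshev N.+1).[x]| <= y ^+ N by exact: ler_piMr.
  by rewrite -!mulrA; nra.
- rewrite lef_pV2 ?posrE//; last by rewrite exprn_gt0// subr_gt0.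
  apply: le_trans _ (sqdist_circle_ge y0 x1).
  by rewrite lerXn2r ?nnegrE; lra.
Qed.

End chebyshev.
Section bounded_measurable.
Context d {T : measurableType d} {R : realType}.
Implicit Types (f g : T -> R).

Definition bounded_measurable f :=
  measurable_fun setT f /\ exists M, forall x, `|f x| <= M.

Lemma bounded_measurable_cst (k : R) : bounded_measurable (fun=> k).
Proof. by split; [exact: measurable_cst|exists `|k|]. Qed.

Lemma bounded_measurableD f g : bounded_measurable f -> bounded_measurable g ->
  bounded_measurable (fun x => f x + g x).
Proof.
move=> [mf [M fM]] [mg [N gN]]; split; first exact: measurable_funD.
by exists (M + N) => x; apply: le_trans (ler_normD _ _) _; exact: lerD.
Qed.

Lemma bounded_measurableM f g : bounded_measurable f -> bounded_measurable g ->
  bounded_measurable (fun x => f x * g x).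
Proof.
move=> [mf [M fM]] [mg [N gN]]; split; first exact: measurable_funM.
by exists (M * N) => x; rewrite normrM; exact: ler_pM.
Qed.

Lemma bounded_measurableN f : bounded_measurable f ->
  bounded_measurable (fun x => - f x).
Proof.
move=> [mf [M fM]]; split; first exact: measurableT_comp.
by exists M => x; rewrite normrN.
Qed.

Lemma bounded_measurableX f n : bounded_measurable f ->
  bounded_measurable (fun x => f x ^+ n).
Proof.
move=> bf; elim: n => [|n IH].
  by under eq_fun do rewrite expr0; exact: bounded_measurable_cst.
by under eq_fun do rewrite exprS; exact: bounded_measurableM.
Qed.

Lemma bounded_measurable_sum n (h : 'I_n -> T -> R) :
  (forall i, bounded_measurable (h i)) ->
  bounded_measurable (fun x => \sum_(i < n) h i x).
Proof.
elim: n h => [|n IH] h bh.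
  by under eq_fun do rewrite big_ord0; exact: bounded_measurable_cst.
under eq_fun do rewrite big_ord_recr /=.
by apply: bounded_measurableD => //; exact: IH.
Qed.

Lemma bounded_measurable_horner (p : {poly R}) f : bounded_measurable f ->
  bounded_measurable (fun x => p.[f x]).
Proof.
move=> bf; under eq_fun do rewrite horner_coef.
apply: bounded_measurable_sum => i; apply: bounded_measurableM.
  exact: bounded_measurable_cst.
exact: bounded_measurableX.
Qed.

Lemma bounded_measurable_cos f : measurable_fun setT f ->
  bounded_measurable (fun x => cos (f x)).
Proof.
move=> mf; split.
  apply: (measurableT_comp _ mf); apply: continuous_measurable_fun => x.
  exact: continuous_cos.
by exists 1 => x; rewrite ler_norml cos_geN1 cos_le1.
Qed.

Lemma bounded_measurable_sin f : measurable_fun setT f ->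
  bounded_measurable (fun x => sin (f x)).
Proof.
move=> mf; split.
  apply: (measurableT_comp _ mf); apply: continuous_measurable_fun => x.
  exact: continuous_sin.
by exists 1 => x; rewrite ler_norml sin_geN1 sin_le1.
Qed.

Lemma bounded_measurable_ln f m : 0 < m -> (forall x, m <= f x) ->
  bounded_measurable f -> bounded_measurable (fun x => ln (f x)).
Proof.
move=> m0 mf [mef [M fM]]; split.
  exact: (measurableT_comp (@measurable_ln R)).
exists (`|ln m| + `|ln M|) => x.
have fx0 : 0 < f x by exact: lt_le_trans (mf x).
have fxM : f x <= M by apply: le_trans (fM x); exact: ler_norm.
have : ln m <= ln (f x) by rewrite ler_ln ?posrE.
have : ln (f x) <= ln M by rewrite ler_ln ?posrE// (lt_le_trans fx0).
have := ler_norm (ln M); have := ler_norm (- ln m); rewrite normrN.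
have := normr_ge0 (ln M); have := normr_ge0 (ln m).
by move=> *; rewrite ler_norml; apply/andP; split; lra.
Qed.

Lemma bounded_measurable_integrable (mu : {measure set T -> \bar R}) D f :
  measurable D -> (mu D < +oo)%E -> bounded_measurable f ->
  mu.-integrable D (EFin \o f).
Proof.
move=> mD muD [mf [M fM]]; apply: measurable_bounded_integrable => //.
  exact: measurable_funTS.
exists M; split; first exact: num_real.
by move=> N MN x _; exact: le_trans (ltW MN).
Qed.

End bounded_measurable.

Section Rintegral_product.
Context d1 d2 (T1 : measurableType d1) (T2 : measurableType d2) (R : realType).
Variables (m1 : {sigma_finite_measure set T1 -> \bar R})
  (m2 : {sigma_finite_measure set T2 -> \bar R}).
Variables (A : set T1) (B : set T2).
Hypotheses (mA : measurable A) (mB : measurable B).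
Hypotheses (A_fin : (m1 A < +oo)%E) (B_fin : (m2 B < +oo)%E).
Variable f : T1 * T2 -> R.
Hypothesis bf : bounded_measurable f.

Lemma bounded_measurable_section1 x : bounded_measurable (fun y => f (x, y)).
Proof.
case: bf => mf [M fM]; split; last by exists M.
exact: (measurableT_comp mf (measurable_pair1 x)).
Qed.

Lemma bounded_measurable_section2 y : bounded_measurable (fun x => f (x, y)).
Proof.
case: bf => mf [M fM]; split; last by exists M.
exact: (measurableT_comp mf (measurable_pair2 y)).
Qed.

Lemma product_measure_setX_lty : ((m1 \x m2)%E (A `*` B) < +oo)%E.
Proof. by rewrite product_measure1E// lte_mul_pinfty// ge0_fin_numE. Qed.

Let patch_integrable : (m1 \x m2)%E.-integrable setT ((EFin \o f) \_ (A `*` B)).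
Proof.
apply/(integrable_mkcond _ (measurableX mA mB)).
apply: bounded_measurable_integrable => //; first exact: measurableX.
exact: product_measure_setX_lty.
Qed.

Lemma Rintegral_prod12 : \int[(m1 \x m2)%E]_(z in A `*` B) f z =
  \int[m1]_(x in A) \int[m2]_(y in B) f (x, y).
Proof.
rewrite /Rintegral integral_mkcond -integral12_prod_meas1//.
rewrite [in RHS]integral_mkcond; congr fine; apply: eq_integral => x _.
rewrite /fubini_F patchE; case: ifPn => [/set_mem Ax|/negP nAx].
  rewrite fineK; last first.
    apply: integrable_fin_num => //; apply: bounded_measurable_integrable => //.
    exact: bounded_measurable_section1.
  rewrite [RHS]integral_mkcond; apply: eq_integral => y _.
  rewrite !patchE; congr (if _ then _ else _).
  by apply/idP/idP => /set_mem h; apply/mem_set => //; case: h.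
apply: integral0_eq => y _; rewrite patchE ifN//.
by apply/negP => /set_mem[/mem_set].
Qed.

Lemma Rintegral_prod21 : \int[(m1 \x m2)%E]_(z in A `*` B) f z =
  \int[m2]_(y in B) \int[m1]_(x in A) f (x, y).
Proof.
rewrite /Rintegral integral_mkcond -integral21_prod_meas1//.
rewrite [in RHS]integral_mkcond; congr fine; apply: eq_integral => y _.
rewrite /fubini_G patchE; case: ifPn => [/set_mem By|/negP nBy].
  rewrite fineK; last first.
    apply: integrable_fin_num => //; apply: bounded_measurable_integrable => //.
    exact: bounded_measurable_section2.
  rewrite [RHS]integral_mkcond; apply: eq_integral => x _.
  rewrite !patchE; congr (if _ then _ else _).
  by apply/idP/idP => /set_mem h; apply/mem_set => //; case: h.
apply: integral0_eq => x _; rewrite patchE ifN//.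
by apply/negP => /set_mem[_ /mem_set].
Qed.

End Rintegral_product.

Section fundamental_theorem.
Context {R : realType}.
Local Notation mu := (@lebesgue_measure R).

Lemma Rintegral_is_derive (F f : R -> R) (a b : R) : a < b ->
  (forall x : R, is_derive x 1 F (f x)) -> continuous f ->
  \int[mu]_(x in `[a, b]) f x = F b - F a.
Proof.
move=> ab dF cf; rewrite /Rintegral (@continuous_FTC2 _ f F)//.
- exact: continuous_subspaceT.
- have cF (x : R) : {for x, continuous F}.
    by apply: differentiable_continuous; apply/derivable1_diffP; case: (dF x).
  split.
  + by move=> x _; case: (dF x).
  + by apply: cvg_at_right_filter; exact: cF.
  + by apply: cvg_at_left_filter; exact: cF.
- by move=> x _; rewrite derive1E; case: (dF x).
Qed.

Lemma lebesgue_measure_segment_lty (a b : R) : (mu `[a, b]%classic < +oo)%E.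
Proof.
by rewrite lebesgue_measure_itv /=; case: ifP => // _; rewrite -EFinB ltry.
Qed.

End fundamental_theorem.

Section sigma_finite_product.
Context d1 d2 (T1 : measurableType d1) (T2 : measurableType d2) (R : realType).
Variables (m1 : {sigma_finite_measure set T1 -> \bar R})
  (m2 : {sigma_finite_measure set T2 -> \bar R}).

(* An alias of the product measure: unification finds the canonical instance of
   sigma-finiteness of [m1 \x m2] only for subprobabilities. *)
Definition sigma_finite_prod := (m1 \x m2)%E.

HB.instance Definition _ := Measure.on sigma_finite_prod.

Let sigma_finite_prodT : sigma_finite setT sigma_finite_prod.
Proof.
have /sigma_finiteP[F [TF ndF Ffin]] := sigma_finiteT m1.
have /sigma_finiteP[G [TG ndG Gfin]] := sigma_finiteT m2.
exists (fun n => F n `*` G n).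
  apply/seteqP; split=> // -[x y] _.
  have [i _ Fx] : (\bigcup_i F i) x by rewrite -TF.
  have [j _ Gy] : (\bigcup_i G i) y by rewrite -TG.
  exists (maxn i j) => //; split=> /=.
  - by have /subsetPset := ndF _ _ (leq_maxl i j); exact.
  - by have /subsetPset := ndG _ _ (leq_maxr i j); exact.
move=> n; have [mF F_lty] := Ffin n; have [mG G_lty] := Gfin n.
split; first exact: measurableX.
exact: product_measure_setX_lty.
Qed.

HB.instance Definition _ := Measure_isSigmaFinite.Build _ _ _
  sigma_finite_prod sigma_finite_prodT.

End sigma_finite_product.

Section hyperspherical_integral.
Context {R : realType}.
Local Notation mu := (@lebesgue_measure R).
Local Notation mu2 := (sigma_finite_prod mu mu).
Local Notation mu3 := (mu2 \x mu)%E.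
Local Notation box2 := (`[0, pi] `*` `[0, pi] : set (R * R)).
Implicit Types (F G : R * R * R -> R) (u : R * R * R) (e : quat R).

Lemma is_derive1_continuous (f : R -> R) (x a : R) : is_derive x 1 f a ->
  {for x, continuous f}.
Proof.
move=> df; apply: differentiable_continuous; apply/derivable1_diffP.
by case: df.
Qed.

Lemma measurable_angle1 : measurable_fun setT (fun u => u.1.1).
Proof. exact: (measurableT_comp measurable_fst measurable_fst). Qed.

Lemma measurable_angle2 : measurable_fun setT (fun u => u.1.2).
Proof. exact: (measurableT_comp measurable_snd measurable_fst). Qed.

Lemma measurable_angle3 : measurable_fun setT (fun u => u.2).
Proof. exact: measurable_snd. Qed.

Lemma measurable_box2 : measurable box2.
Proof. exact: measurableX. Qed.

Lemma box2_lty : (mu2 box2 < +oo)%E.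
Proof.
apply: (@product_measure_setX_lty _ _ _ _ _ mu mu);
  exact: measurable_itv || exact: lebesgue_measure_segment_lty.
Qed.

Lemma sphere_box_lty : (mu3 sphere_box < +oo)%E.
Proof.
apply: (@product_measure_setX_lty _ _ _ _ _ mu2 mu).
- exact: measurable_box2.
- exact: measurable_itv.
- exact: box2_lty.
- exact: lebesgue_measure_segment_lty.
Qed.

Lemma bounded_measurable_box_integrable F : bounded_measurable F ->
  mu3.-integrable sphere_box (EFin \o F).
Proof.
move=> bF; apply: (@bounded_measurable_integrable _ _ R mu3 sphere_box F) => //.
  exact: measurable_sphere_box.
exact: sphere_box_lty.
Qed.

Lemma box_integral_angle3 F : bounded_measurable F ->
  \int[mu3]_(u in sphere_box) F u =
  \int[mu2]_(v in box2) \int[mu]_(t in `[0, 2 * pi]) F (v, t).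
Proof.
move=> bF; apply: (@Rintegral_prod12 _ _ _ _ _ mu2 mu) => //.
- exact: measurable_box2.
- exact: box2_lty.
- exact: lebesgue_measure_segment_lty.
Qed.

Lemma box_integral_angle12 F : bounded_measurable F ->
  \int[mu3]_(u in sphere_box) F u =
  \int[mu]_(z in `[0, 2 * pi]) \int[mu2]_(v in box2) F (v, z).
Proof.
move=> bF; apply: (@Rintegral_prod21 _ _ _ _ _ mu2 mu) => //.
- exact: measurable_box2.
- exact: box2_lty.
- exact: lebesgue_measure_segment_lty.
Qed.

Lemma Rintegral_eq0 d (T : measurableType d) (m : {measure set T -> \bar R})
  (D : set T) (f : T -> R) : (forall x, D x -> f x = 0) ->
  \int[m]_(x in D) f x = 0.
Proof. by move=> f0; rewrite /Rintegral integral0_eq// => x /f0 ->. Qed.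

Lemma box_integral_eq0_3 F : bounded_measurable F ->
  (forall x y, \int[mu]_(t in `[0, 2 * pi]) F (x, y, t) = 0) ->
  \int[mu3]_(u in sphere_box) F u = 0.
Proof.
by move=> bF F0; rewrite box_integral_angle3// Rintegral_eq0// => -[].
Qed.

Lemma box_integral_eq0_2 F : bounded_measurable F ->
  (forall x z, \int[mu]_(t in `[0, pi]) F (x, t, z) = 0) ->
  \int[mu3]_(u in sphere_box) F u = 0.
Proof.
move=> bF F0; rewrite box_integral_angle12// Rintegral_eq0// => z _.
rewrite (@Rintegral_prod12 _ _ _ _ _ mu mu)//.
- by rewrite Rintegral_eq0.
- exact: lebesgue_measure_segment_lty.
- exact: lebesgue_measure_segment_lty.
- exact: (bounded_measurable_section2 bF).
Qed.

Lemma box_integral_eq0_1 F : bounded_measurable F ->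
  (forall y z, \int[mu]_(t in `[0, pi]) F (t, y, z) = 0) ->
  \int[mu3]_(u in sphere_box) F u = 0.
Proof.
move=> bF F0; rewrite box_integral_angle12// Rintegral_eq0// => z _.
rewrite (@Rintegral_prod21 _ _ _ _ _ mu mu)//.
- by rewrite Rintegral_eq0.
- exact: lebesgue_measure_segment_lty.
- exact: lebesgue_measure_segment_lty.
- exact: (bounded_measurable_section2 bF).
Qed.

Definition box_weight u : R := sin u.1.1 ^+ 2 * sin u.1.2.

Definition sphere_integral F : R :=
  \int[mu3]_(u in sphere_box) (F u * box_weight u).

Lemma bounded_measurable_weight : bounded_measurable box_weight.
Proof.
apply: bounded_measurableM; [apply: bounded_measurableX|];
  apply: bounded_measurable_sin.
- exact: measurable_angle1.
- exact: measurable_angle2.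
Qed.

Lemma box_weight_ge0 u : sphere_box u -> 0 <= box_weight u.
Proof.
move=> [[_ /=]]; rewrite in_itv/= => u2 _.
by apply: mulr_ge0; [exact: sqr_ge0|exact: sin_ge0_pi].
Qed.

Let weighted_integrable F : bounded_measurable F ->
  mu3.-integrable sphere_box (EFin \o (fun u => F u * box_weight u)).
Proof.
move=> bF; apply: bounded_measurable_box_integrable.
exact: bounded_measurableM bounded_measurable_weight.
Qed.

Lemma sphere_integralD F G : bounded_measurable F -> bounded_measurable G ->
  sphere_integral (fun u => F u + G u) = sphere_integral F + sphere_integral G.
Proof.
move=> bF bG; rewrite /sphere_integral; under eq_Rintegral do rewrite mulrDl.
apply: RintegralD; first exact: measurable_sphere_box.
  exact: weighted_integrable.
exact: weighted_integrable.
Qed.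

Lemma sphere_integralZ k F : bounded_measurable F ->
  sphere_integral (fun u => k * F u) = k * sphere_integral F.
Proof.
move=> bF; rewrite /sphere_integral; under eq_Rintegral do rewrite -mulrA.
apply: RintegralZl; first exact: measurable_sphere_box.
exact: weighted_integrable.
Qed.

Lemma sphere_integral_sum n (k : 'I_n -> R) (H : 'I_n -> R * R * R -> R) :
  (forall i, bounded_measurable (H i)) ->
  sphere_integral (fun u => \sum_(i < n) k i * H i u) =
  \sum_(i < n) k i * sphere_integral (H i).
Proof.
elim: n k H => [|n IH] k H bH.
  rewrite big_ord0 /sphere_integral Rintegral_eq0// => u _.
  by rewrite big_ord0 mul0r.
rewrite big_ord_recr /= -IH// -sphere_integralZ// -sphere_integralD.
- by congr sphere_integral; apply/funext => u; rewrite big_ord_recr.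
- apply: bounded_measurable_sum => i; apply: bounded_measurableM => //.
  exact: bounded_measurable_cst.
- by apply: bounded_measurableM => //; exact: bounded_measurable_cst.
Qed.

Lemma le_sphere_integral_norm F k : bounded_measurable F ->
  (forall u, `|F u| <= k) ->
  `|sphere_integral F| <= k * sphere_integral (fun=> 1).
Proof.
move=> bF Fk; rewrite -sphere_integralZ; last exact: bounded_measurable_cst.
have bFW : bounded_measurable (fun u => F u * box_weight u).
  exact: bounded_measurableM bounded_measurable_weight.
apply: le_trans (le_normr_Rintegral _ _) _; first exact: measurable_sphere_box.
  exact: bounded_measurable_box_integrable.
apply: le_Rintegral => //; first exact: measurable_sphere_box.
- exact: (integrable_norm (bounded_measurable_box_integrable bFW)).
- apply: weighted_integrable.
  by under eq_fun do rewrite mulr1; exact: bounded_measurable_cst.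
- move=> u /box_weight_ge0 W0; rewrite mulr1 normrM (ger0_norm W0).
  exact: ler_wpM2r.
Qed.

Lemma bounded_measurable_angle1 (f : R -> R) : bounded_measurable f ->
  bounded_measurable (fun u : R * R * R => f u.1.1).
Proof.
move=> [mf [M fM]]; split; last by exists M.
exact: (measurableT_comp mf measurable_angle1).
Qed.

Lemma Rintegral_sin_0_pi : \int[mu]_(t in `[0, pi]) sin t = 2.
Proof.
have dF (x : R) : is_derive x 1 (fun t : R => - cos t) (sin x).
  by is_derive1_tac; rewrite opprK.
rewrite (Rintegral_is_derive (pi_gt0 R) dF); last first.
  by move=> x; exact: continuous_sin.
by rewrite cospi cos0; ring.
Qed.

(* The factor 4 pi is the area of the unit 2-sphere. *)
Lemma sphere_integral_angle1 (f : R -> R) : bounded_measurable f ->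
  sphere_integral (fun u => f u.1.1) =
  4 * pi * \int[mu]_(t in `[0, pi]) (f t * sin t ^+ 2).
Proof.
move=> bf.
have bF : bounded_measurable (fun u => f u.1.1 * box_weight u).
  apply: bounded_measurableM bounded_measurable_weight.
  exact: bounded_measurable_angle1.
rewrite /sphere_integral box_integral_angle12//.
have bs : bounded_measurable (fun t : R => sin t).
  by apply: bounded_measurable_sin; exact: measurable_id.
have bg : bounded_measurable (fun t : R => f t * sin t ^+ 2).
  by apply: bounded_measurableM => //; exact: bounded_measurableX.
have I_lty : (mu `[0%R, pi]%classic < +oo)%E.
  exact: lebesgue_measure_segment_lty.
have inner (z : R) : \int[mu2]_(v in box2) (f v.1 * box_weight (v, z)) =
    2 * \int[mu]_(t in `[0, pi]) (f t * sin t ^+ 2).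
  rewrite (@Rintegral_prod12 _ _ _ _ _ mu mu)//; last first.
    exact: (bounded_measurable_section2 bF).
  rewrite mulrC -RintegralZr//; last exact: bounded_measurable_integrable.
  apply: eq_Rintegral => x _; rewrite -[2]Rintegral_sin_0_pi.
  rewrite -RintegralZl//; last exact: bounded_measurable_integrable.
  by apply: eq_Rintegral => y _; rewrite /box_weight /= mulrA.
under eq_Rintegral do rewrite inner.
have len : fine (mu `[0%R, (2 * pi)%R]%classic) = 2 * pi.
  by rewrite lebesgue_measure_itv /= lte_fin mulr_gt0 ?pi_gt0//= subr0.
rewrite Rintegral_cst//; set I := \int[mu]_(t in _) _.
transitivity (2 * I * (2 * pi)); last by ring.
by congr (_ * _); exact: len.
Qed.

End hyperspherical_integral.

Section zonal_moments.
Context {R : realType}.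
Local Notation mu := (@lebesgue_measure R).
Local Notation mu3 := (sigma_finite_prod mu mu \x mu)%E.
Implicit Types (e : quat R) (u : R * R * R) (m n : nat).

Definition zonal e u : R := quat_dot (sphere_param 1 u) e.

Let g e u := q2 e * cos u.2 + q3 e * sin u.2.
Let dg e u := q3 e * cos u.2 - q2 e * sin u.2.
Let f e u := q1 e * cos u.1.2 + g e u * sin u.1.2.
Let df e u := g e u * cos u.1.2 - q1 e * sin u.1.2.
Let dz e u := f e u * cos u.1.1 - q0 e * sin u.1.1.

Lemma zonalE e u : zonal e u = q0 e * cos u.1.1 + (q1 e * cos u.1.2 +
  (q2 e * cos u.2 + q3 e * sin u.2) * sin u.1.2) * sin u.1.1.
Proof. by rewrite /zonal /quat_dot /=; ring. Qed.

Lemma zonal_gradient_sqr e u :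
  zonal e u ^+ 2 + dz e u ^+ 2 + df e u ^+ 2 + dg e u ^+ 2 = quat_sqn e.
Proof.
have -> : zonal e u = q0 e * cos u.1.1 + f e u * sin u.1.1 by rewrite zonalE.
have c1 := cos2Dsin2 u.1.1; have c2 := cos2Dsin2 u.1.2.
have c3 := cos2Dsin2 u.2.
transitivity ((q0 e ^+ 2 + f e u ^+ 2) * (cos u.1.1 ^+ 2 + sin u.1.1 ^+ 2)
  + df e u ^+ 2 + dg e u ^+ 2); first by rewrite /dz; ring.
rewrite c1 mulr1; transitivity (q0 e ^+ 2 +
  (q1 e ^+ 2 + g e u ^+ 2) * (cos u.1.2 ^+ 2 + sin u.1.2 ^+ 2) + dg e u ^+ 2).
  by rewrite /f /df; ring.
rewrite c2 mulr1; transitivity (q0 e ^+ 2 + q1 e ^+ 2 +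
  (q2 e ^+ 2 + q3 e ^+ 2) * (cos u.2 ^+ 2 + sin u.2 ^+ 2)).
  by rewrite /g /dg; ring.
by rewrite c3 /quat_sqn; ring.
Qed.

Lemma normr_zonal_le1 e u : quat_sqn e = 1 -> `|zonal e u| <= 1.
Proof.
move=> e1; have := zonal_gradient_sqr e u; rewrite e1.
have := sqr_ge0 (dz e u); have := sqr_ge0 (df e u); have := sqr_ge0 (dg e u).
by move=> h1 h2 h3 h4; rewrite ler_norml; apply/andP; split; nra.
Qed.

Ltac bounded_measurable_tac :=
  repeat first
    [ exact: bounded_measurable_cst
    | apply: bounded_measurable_cos | apply: bounded_measurable_sin
    | exact: measurable_angle1 | exact: measurable_angle2
    | exact: measurable_angle3
    | apply: bounded_measurableD | apply: bounded_measurableN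
    | apply: bounded_measurableM | apply: bounded_measurableX ].

Ltac continuous_tac :=
  let x := fresh in move=> x;
  notypeclasses refine (is_derive1_continuous _); repeat is_derive1_step.

Lemma bounded_measurable_zonal e : bounded_measurable (zonal e).
Proof. by rewrite (funext (zonalE e)); bounded_measurable_tac. Qed.

(* With V the gradient on the 3-sphere of zonal e ^+ m.+1 / m.+1, these are the
   three terms of the divergence of V times box_weight. *)
Let div1 e m u := sin u.1.2 * (
    2 * sin u.1.1 * cos u.1.1 * dz e u * zonal e u ^+ m
  - sin u.1.1 ^+ 2 * zonal e u * zonal e u ^+ m
  + sin u.1.1 ^+ 2 * dz e u * (m%:R * zonal e u ^+ m.-1 * dz e u)).
Let div2 e m u := sin u.1.1 * (cos u.1.2 * df e u * zonal e u ^+ m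
  - sin u.1.2 * f e u * zonal e u ^+ m
  + sin u.1.2 * df e u * (m%:R * zonal e u ^+ m.-1 * (sin u.1.1 * df e u))).
Let div3 e m u := sin u.1.1 * (- g e u * zonal e u ^+ m
  + dg e u * (m%:R * zonal e u ^+ m.-1 * (sin u.1.1 * sin u.1.2 * dg e u))).

Lemma div1_eq0 e m y z : \int[mu]_(t in `[0, pi]) div1 e m (t, y, z) = 0.
Proof.
pose F (t : R) := sin y * (sin t ^+ 2 * dz e (t, y, z) *
   (q0 e * cos t + f e (0, y, z) * sin t) ^+ m).
have zE (t : R) : zonal e (t, y, z) = q0 e * cos t + f e (0, y, z) * sin t.
  by rewrite zonalE.
have dF (t : R) : is_derive t 1 F (div1 e m (t, y, z)).
  rewrite /F /div1 zE /dz /f /g /=.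
  by is_derive1_tac; rewrite /= ?expr1; ring.
rewrite (Rintegral_is_derive (pi_gt0 R) dF).
  by rewrite /F sinpi sin0 expr0n /= !(mul0r, mulr0) subrr.
rewrite /div1 /dz /f /g /zonal /quat_dot /=.
by continuous_tac.
Qed.

Lemma div2_eq0 e m x z : \int[mu]_(t in `[0, pi]) div2 e m (x, t, z) = 0.
Proof.
pose F (t : R) := sin x * (sin t * df e (x, t, z) *
   (q0 e * cos x + (q1 e * cos t + g e (x, 0, z) * sin t) * sin x) ^+ m).
have zE (t : R) : zonal e (x, t, z) =
    q0 e * cos x + (q1 e * cos t + g e (x, 0, z) * sin t) * sin x.
  by rewrite zonalE.
have dF (t : R) : is_derive t 1 F (div2 e m (x, t, z)).
  rewrite /F /div2 zE /df /f /g /=.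
  by is_derive1_tac; rewrite /=; ring.
rewrite (Rintegral_is_derive (pi_gt0 R) dF).
  by rewrite /F sinpi sin0 !(mul0r, mulr0) subrr.
rewrite /div2 /df /f /g /zonal /quat_dot /=.
by continuous_tac.
Qed.

Lemma div3_eq0 e m x y : \int[mu]_(t in `[0, 2 * pi]) div3 e m (x, y, t) = 0.
Proof.
pose Z t := q0 e * cos x + (q1 e * cos y +
  (q2 e * cos t + q3 e * sin t) * sin y) * sin x.
pose F (t : R) := sin x * ((q3 e * cos t - q2 e * sin t) * Z t ^+ m).
have zE (t : R) : zonal e (x, y, t) = Z t.
  by rewrite zonalE.
have dF (t : R) : is_derive t 1 F (div3 e m (x, y, t)).
  rewrite /F /div3 zE /Z /dg /g /=.
  by is_derive1_tac; rewrite /=; ring.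
have pi2 : (0 : R) < 2 * pi by rewrite mulr_gt0 ?pi_gt0.
rewrite (Rintegral_is_derive pi2 dF).
  by rewrite /F /Z mulr_natl sin2pi cos2pi sin0 cos0 subrr.
rewrite /div3 /dg /g /zonal /quat_dot /=.
by continuous_tac.
Qed.

Lemma divergenceE e m u : quat_sqn e = 1 ->
  div1 e m u + div2 e m u + div3 e m u =
  m%:R * zonal e u ^+ m.-1 * box_weight u
  - (m%:R + 3) * zonal e u ^+ m.+1 * box_weight u.
Proof.
move=> e1.
have zE : zonal e u = q0 e * cos u.1.1 + f e u * sin u.1.1 by rewrite zonalE.
have := zonal_gradient_sqr e u; rewrite e1 => grad.
have c1 := cos2Dsin2 u.1.1; have c2 := cos2Dsin2 u.1.2.
pose Zm := zonal e u ^+ m; pose Zm1 := m%:R * zonal e u ^+ m.-1.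
have hZ : m%:R * zonal e u ^+ m.+1 = Zm1 * zonal e u ^+ 2.
  rewrite /Zm1; case: (m) => [|k]; first by rewrite !mul0r.
  by rewrite /= !exprS; ring.
rewrite /div1 /div2 /div3 [(m%:R + 3) * _]mulrDl hZ.
rewrite [zonal e u ^+ m.+1]exprS -/Zm -/Zm1; clearbody Zm Zm1.
apply: subr0_eq; transitivity (Zm1 * box_weight u *
    (zonal e u ^+ 2 + dz e u ^+ 2 + df e u ^+ 2 + dg e u ^+ 2 - 1) +
  Zm * (sin u.1.1 * g e u * (cos u.1.2 ^+ 2 + sin u.1.2 ^+ 2 - 1) +
    2 * sin u.1.1 * sin u.1.2 * f e u * (cos u.1.1 ^+ 2 + sin u.1.1 ^+ 2 - 1))).
  by rewrite /box_weight zE /dz /df /f; ring.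
by rewrite grad c1 c2; ring.
Qed.

Lemma zonal_moment_rec e m : quat_sqn e = 1 ->
  (m%:R + 3) * sphere_integral (fun u => zonal e u ^+ m.+1) =
  m%:R * sphere_integral (fun u => zonal e u ^+ m.-1).
Proof.
move=> e1; have bz := bounded_measurable_zonal e.
have b1 : bounded_measurable (div1 e m).
  by rewrite /div1 /dz /f /g; bounded_measurable_tac.
have b2 : bounded_measurable (div2 e m).
  by rewrite /div2 /df /f /g; bounded_measurable_tac.
have b3 : bounded_measurable (div3 e m).
  by rewrite /div3 /dg /g; bounded_measurable_tac.
have i1 := box_integral_eq0_1 b1 (div1_eq0 e m).
have i2 := box_integral_eq0_2 b2 (div2_eq0 e m).
have i3 := box_integral_eq0_3 b3 (div3_eq0 e m).
have bZ k : bounded_measurable (fun u => zonal e u ^+ k).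
  exact: bounded_measurableX.
have iZ k n : mu3.-integrable sphere_box
    (EFin \o (fun u => k * zonal e u ^+ n * box_weight u)).
  apply: bounded_measurable_box_integrable.
  apply: bounded_measurableM bounded_measurable_weight.
  by apply: bounded_measurableM => //; exact: bounded_measurable_cst.
have mB := @measurable_sphere_box R.
have int0 : \int[mu3]_(u in sphere_box)
    (div1 e m u + div2 e m u + div3 e m u) = 0.
  have b12 := bounded_measurableD b1 b2.
  rewrite RintegralD//; try exact: bounded_measurable_box_integrable.
  rewrite RintegralD//; try exact: bounded_measurable_box_integrable.
  by rewrite i1 i2 i3 !addr0.
rewrite -!sphere_integralZ//; apply/esym/subr0_eq; rewrite -int0.
rewrite /sphere_integral -RintegralB//.
- by apply: eq_Rintegral => u _; rewrite divergenceE.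
- exact: iZ.
- exact: iZ.
Qed.

Lemma zonal_moment_eq e e' n : quat_sqn e = 1 -> quat_sqn e' = 1 ->
  sphere_integral (fun u => zonal e u ^+ n) =
  sphere_integral (fun u => zonal e' u ^+ n).
Proof.
move=> e1 e'1.
have step m (E : sphere_integral (fun u => zonal e u ^+ m.-1) =
     sphere_integral (fun u => zonal e' u ^+ m.-1)) :
    sphere_integral (fun u => zonal e u ^+ m.+1) =
    sphere_integral (fun u => zonal e' u ^+ m.+1).
  have m3 : (m%:R + 3 : R) != 0 by rewrite gt_eqF// ltr_wpDl.
  by apply: (mulfI m3); rewrite !zonal_moment_rec// E.
have z0 : sphere_integral (fun u => zonal e u ^+ 0) =
  sphere_integral (fun u => zonal e' u ^+ 0) by [].
suff : sphere_integral (fun u => zonal e u ^+ n) =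
    sphere_integral (fun u => zonal e' u ^+ n) /\
  sphere_integral (fun u => zonal e u ^+ n.+1) =
    sphere_integral (fun u => zonal e' u ^+ n.+1) by case.
elim: n => [|n [IH1 IH2]]; first by split=> //; exact: (step 0%N).
by split=> //; exact: (step n.+1).
Qed.

End zonal_moments.
Section logarithmic_integrals.
Context {R : realType}.
Local Notation mu := (@lebesgue_measure R).
Implicit Types (e : quat R) (u : R * R * R) (n : nat) (s t : R).

Lemma sphere_integral_horner_zonal (p : {poly R}) e : quat_sqn e = 1 ->
  sphere_integral (fun u => p.[zonal e u]) =
  sphere_integral (fun u => p.[cos u.1.1]).
Proof.
move=> e1; pose e0 : quat R := Quat 1 0 0 0.
have e01 : quat_sqn e0 = 1 by rewrite /quat_sqn /=; ring.
have -> : (fun u => p.[cos u.1.1]) = (fun u => p.[zonal e0 u]).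
  by apply/funext => u; rewrite zonalE /=; congr horner; ring.
rewrite (funext (fun u => horner_coef p (zonal e u))).
rewrite (funext (fun u => horner_coef p (zonal e0 u))).
have bX e' k : bounded_measurable (fun u => zonal e' u ^+ k).
  exact/bounded_measurableX/bounded_measurable_zonal.
rewrite !sphere_integral_sum//.
by apply: eq_bigr => i _; rewrite (zonal_moment_eq _ e1 e01).
Qed.

Lemma sin_natr_pi n : sin (n%:R * pi) = 0 :> R.
Proof.
elim: n => [|n IH]; first by rewrite mul0r sin0.
by rewrite -natr1 mulrDl mul1r sinD IH sinpi mul0r mulr0 addr0.
Qed.

Lemma Rintegral_cos_natr n :
  \int[mu]_(t in `[0, pi]) cos (n%:R * t) = if n is 0 then pi else 0.
Proof.
case: n => [|n].
  under eq_Rintegral do rewrite mul0r cos0.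
  have dF (x : R) : is_derive x 1 (fun t : R => t) (1 : R).
    exact: is_derive1_fct_id.
  rewrite (Rintegral_is_derive (pi_gt0 R) dF) ?subr0//.
  exact: cst_continuous.
have dmul (k x : R) : is_derive x 1 (fun t : R => k * t) k.
  by is_derive1_tac; rewrite /=; ring.
have dF (x : R) : is_derive x 1 (fun t : R => n.+1%:R^-1 * sin (n.+1%:R * t))
    (cos (n.+1%:R * x)).
  have ds : is_derive x 1 (fun t : R => sin (n.+1%:R * t))
      (cos (n.+1%:R * x) * n.+1%:R).
    exact: (@is_derive1_comp _ (@sin R) (fun t => n.+1%:R * t)).
  have n0 : (n.+1%:R : R) != 0 by rewrite pnatr_eq0.
  by is_derive1_tac; rewrite /=; field.
rewrite (Rintegral_is_derive (pi_gt0 R) dF).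
  by rewrite sin_natr_pi !mulr0 sin0 mulr0 subrr.
have dc (x : R) : is_derive x 1 (fun t : R => cos (n.+1%:R * t))
    (- sin (n.+1%:R * x) * n.+1%:R).
  exact: (@is_derive1_comp _ (@cos R) (fun t => n.+1%:R * t)).
by move=> x; exact: is_derive1_continuous (dc x).
Qed.

Lemma cos_natr_mul_sin2 n t : cos (n%:R * t) * sin t ^+ 2 =
  4^-1 * (2 * cos (n%:R * t) - cos ((n + 2)%:R * t)
          - cos ((n - 2 + (2 - n))%:R * t)).
Proof.
have -> : cos ((n - 2 + (2 - n))%:R * t) = cos (n%:R * t - 2 * t).
  case: (leqP 2 n) => [n2|n2].
    have -> : (2 - n = 0)%N by apply/eqP; rewrite subn_eq0.
    by rewrite addn0 natrB// mulrBl.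
  have -> : (n - 2 = 0)%N by apply/eqP; rewrite subn_eq0 ltnW.
  by rewrite add0n natrB ?(ltnW n2)// -cosN; congr cos; ring.
rewrite natrD [(_ + _) * t]mulrDl [cos (_ - _)]cosB [cos (_ + _)]cosD.
have -> : 2 * t = t *+ 2 by rewrite mulr_natl.
rewrite cos_mulr2n cos2sin2.
by field.
Qed.

Lemma sphere_integral_cos_natr n :
  sphere_integral (fun u => cos (n%:R * u.1.1)) =
  pi ^+ 2 * (2 * (n == 0)%:R - (n == 2)%:R).
Proof.
have bc k : bounded_measurable (fun t : R => cos (k%:R * t)).
  by apply: bounded_measurable_cos; exact: measurable_funM.
rewrite (@sphere_integral_angle1 _ (fun t => cos (n%:R * t)))//.
have int F : bounded_measurable F -> mu.-integrable `[0, pi] (EFin \o F).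
  move=> bF; apply: bounded_measurable_integrable => //.
  exact: lebesgue_measure_segment_lty.
under eq_Rintegral do rewrite cos_natr_mul_sin2.
have bn k F : bounded_measurable F -> bounded_measurable (fun t : R => k * F t).
  by move=> bF; apply: bounded_measurableM => //; exact: bounded_measurable_cst.
have bB (F G : R -> R) : bounded_measurable F -> bounded_measurable G ->
    bounded_measurable (fun t : R => F t - G t).
  by move=> bF bG; apply: bounded_measurableD => //; exact: bounded_measurableN.
rewrite RintegralZl//; last first.
  by apply: (int); apply: (bB); [apply: (bB); [apply: (bn)|]|]; exact: (bc).
rewrite RintegralB//; last 2 first.
- by apply: (int); apply: (bB); [apply: (bn)|]; exact: (bc).
- by apply: (int); exact: (bc).
rewrite RintegralB//; last 2 first.
- by apply: (int); apply: (bn); exact: (bc).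
- by apply: (int); exact: (bc).
rewrite RintegralZl//; last by apply: (int); exact: (bc).
rewrite !Rintegral_cos_natr.
case: n => [|[|[|n]]] /=; rewrite ?subSS ?subn0 ?addnS /=; by field.
Qed.

Lemma sphere_integral1 : sphere_integral (fun=> 1 : R) = 2 * pi ^+ 2.
Proof.
have := sphere_integral_cos_natr 0; rewrite /= subr0 mulr1 mulrC => <-.
by congr sphere_integral; apply/funext => u; rewrite mul0r cos0.
Qed.

Lemma sphere_integral_cos2 :
  sphere_integral (fun u => cos (2 * u.1.1)) = - pi ^+ 2.
Proof. by rewrite (sphere_integral_cos_natr 2) /= mulr0 sub0r mulrN1. Qed.

Lemma sphere_integral_cos_eq0 n : n != 1%N ->
  sphere_integral (fun u => cos (n.+1%:R * u.1.1)) = 0.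
Proof.
move=> n1; rewrite sphere_integral_cos_natr eqSS (negbTE n1) /=.
by rewrite mulr0 subr0 mulr0.
Qed.

Lemma bounded_measurable_ln_sqdist s (tau : R * R * R -> R) : 0 <= s < 1 ->
  bounded_measurable tau -> (forall u, `|tau u| <= 1) ->
  bounded_measurable (fun u => ln (sqdist_circle s (tau u))).
Proof.
move=> /andP[s0 s1] btau tau1.
apply: (@bounded_measurable_ln _ _ _ _ ((1 - s) ^+ 2)).
- by rewrite exprn_gt0// subr_gt0.
- by move=> u; exact: sqdist_circle_ge.
- rewrite /sqdist_circle; apply: bounded_measurableD.
    exact: bounded_measurable_cst.
  apply: bounded_measurableN; apply: bounded_measurableM => //.
  exact: bounded_measurable_cst.
Qed.

Lemma sphere_integral_ln_sqdist s (tau1 tau2 : R * R * R -> R) : 0 <= s < 1 ->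
  bounded_measurable tau1 -> bounded_measurable tau2 ->
  (forall u, `|tau1 u| <= 1) -> (forall u, `|tau2 u| <= 1) ->
  (forall n, n != 1%N ->
     sphere_integral (fun u => (chebyshev n.+1).[tau1 u]) +
     sphere_integral (fun u => (chebyshev n.+1).[tau2 u]) = 0) ->
  sphere_integral (fun u => ln (sqdist_circle s (tau1 u))) +
  sphere_integral (fun u => ln (sqdist_circle s (tau2 u))) =
  - (s ^+ 2 * (sphere_integral (fun u => (chebyshev 2).[tau1 u]) +
               sphere_integral (fun u => (chebyshev 2).[tau2 u]))).
Proof.
move=> s01 b1 b2 le1 le2 T0; have /andP[s0 s1] := s01.
set X := (X in - (_ * X)).
pose S N (tau : R * R * R -> R) u := ln_sqdist_sum N s (tau u).
have bS N tau : bounded_measurable tau -> bounded_measurable (S N tau).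
  move=> bt; apply: bounded_measurableN; apply: bounded_measurableM.
    exact: bounded_measurable_cst.
  apply: bounded_measurable_sum => i; apply: bounded_measurableM.
    exact: bounded_measurable_cst.
  exact: bounded_measurable_horner.
have iS N tau : bounded_measurable tau -> sphere_integral (S N tau) =
    - (2 * \sum_(i < N) s ^+ i.+1 / i.+1%:R *
        sphere_integral (fun u => (chebyshev i.+1).[tau u])).
  move=> bt; rewrite -sphere_integral_sum; last first.
    by move=> i; exact: bounded_measurable_horner.
  rewrite -mulNr -sphere_integralZ; last first.
    apply: bounded_measurable_sum => i; apply: bounded_measurableM.
      exact: bounded_measurable_cst.
    exact: bounded_measurable_horner.
  by congr sphere_integral; apply/funext => u; rewrite mulNr.
have sumS N : sphere_integral (S N.+2 tau1) + sphere_integral (S N.+2 tau2) =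
    - (s ^+ 2 * X).
  rewrite !iS// -opprD -mulrDr -big_split /=; congr (- _).
  under eq_bigr do rewrite -mulrDr.
  rewrite (bigD1 (Ordinal (isT : 1 < N.+2)%N))//= big1.
    by rewrite addr0 -/X; field.
  by move=> i i1; rewrite T0 ?mulr0.
have approx N tau : bounded_measurable tau -> (forall u, `|tau u| <= 1) ->
    `|sphere_integral (fun u => ln (sqdist_circle s (tau u))) -
      sphere_integral (S N tau)| <=
    4 * s ^+ N.+1 / (1 - s) ^+ 2 * sphere_integral (fun=> 1).
  move=> bt tle; have bl := bounded_measurable_ln_sqdist s01 bt tle.
  rewrite -[- sphere_integral (S N tau)]mulN1r.
  rewrite -(sphere_integralZ (-1)); last exact: bS.
  rewrite -sphere_integralD//; last first.
    by apply: bounded_measurableM; [exact: bounded_measurable_cst|exact: bS].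
  apply: le_sphere_integral_norm.
    apply: bounded_measurableD => //; apply: bounded_measurableM.
      exact: bounded_measurable_cst.
    exact: bS.
  by move=> u; rewrite mulN1r; exact: ln_sqdist_approx.
apply/subr0_eq/eqP; rewrite -normr_le0.
pose K := 8 * s ^+ 3 / (1 - s) ^+ 2 * sphere_integral (fun=> 1 : R).
have sn1 : `|s| < 1 by rewrite ger0_norm.
apply: (ler_cvg_to (@cvg_cst _ _ _ _ _) (cvg_geometric K sn1)).
apply: nearW => N; rewrite /geometric /=.
rewrite -(sumS N).
set l1 := sphere_integral _; set l2 := sphere_integral _.
have -> : forall a b : R, l1 + l2 - (a + b) = (l1 - a) + (l2 - b).
  by move=> a b; ring.
apply: le_trans (ler_normD _ _) _.
apply: le_trans (lerD (approx N.+2 _ b1 le1) (approx N.+2 _ b2 le2)) _.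
have -> : s ^+ N.+3 = s ^+ 3 * s ^+ N by rewrite -exprD.
rewrite /K; set i1 := sphere_integral _.
suff -> : 4 * (s ^+ 3 * s ^+ N) / (1 - s) ^+ 2 * i1 +
  4 * (s ^+ 3 * s ^+ N) / (1 - s) ^+ 2 * i1 =
  8 * s ^+ 3 / (1 - s) ^+ 2 * i1 * s ^+ N by [].
by ring.
Qed.

Lemma sphere_integral_ln_zonal e s : quat_sqn e = 1 -> 0 <= s < 1 ->
  sphere_integral (fun u => ln (sqdist_circle s (zonal e u))) =
  pi ^+ 2 * s ^+ 2.
Proof.
move=> e1 s01; have be := bounded_measurable_zonal e.
have T n : sphere_integral (fun u => (chebyshev n).[zonal e u]) =
    sphere_integral (fun u => cos (n%:R * u.1.1)).
  rewrite sphere_integral_horner_zonal//.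
  by congr sphere_integral; apply/funext => u; rewrite horner_chebyshev_cos.
have e_le1 u := normr_zonal_le1 u e1.
apply: (mulfI (_ : (2 : R) != 0)) => //.
rewrite [LHS]mulr_natl mulr2n sphere_integral_ln_sqdist//.
  by rewrite T sphere_integral_cos2; ring.
by move=> n n1; rewrite !T sphere_integral_cos_eq0// addr0.
Qed.

Lemma sphere_integral_ln_cos_pair s t : 0 <= s < 1 ->
  sphere_integral (fun u => ln (sqdist_circle s (cos (u.1.1 - t)))) +
  sphere_integral (fun u => ln (sqdist_circle s (cos (u.1.1 + t)))) =
  2 * pi ^+ 2 * s ^+ 2 * cos (2 * t).
Proof.
move=> s01.
have bD (k : R) : bounded_measurable (fun u : R * R * R => cos (u.1.1 + k)).
  apply: bounded_measurable_cos; apply: measurable_funD => //.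
  exact: measurable_angle1.
have T n : sphere_integral (fun u => (chebyshev n).[cos (u.1.1 - t)]) +
    sphere_integral (fun u => (chebyshev n).[cos (u.1.1 + t)]) =
    2 * cos (n%:R * t) * sphere_integral (fun u => cos (n%:R * u.1.1)).
  rewrite -sphere_integralZ; last first.
    apply: bounded_measurable_cos; apply: measurable_funM => //.
    exact: measurable_angle1.
  rewrite -sphere_integralD; [|exact: bounded_measurable_horner..].
  congr sphere_integral; apply/funext => u.
  by rewrite !horner_chebyshev_cos mulrBr mulrDr cosB cosD; ring.
rewrite sphere_integral_ln_sqdist//.
- by rewrite T sphere_integral_cos2; ring.
- by move=> u; rewrite ler_norml cos_geN1 cos_le1.
- by move=> u; rewrite ler_norml cos_geN1 cos_le1.
- by move=> n n1; rewrite T sphere_integral_cos_eq0// mulr0.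
Qed.

End logarithmic_integrals.

Section weighted_pushforward.
Context d1 d2 (X : measurableType d1) (Y : measurableType d2) (R : realType).
Variables (mu : {measure set X -> \bar R}) (nu : {measure set Y -> \bar R}).
Variables (phi : X -> Y) (D : set X) (w : X -> R).
Hypotheses (mphi : measurable_fun setT phi) (mD : measurable D).
Hypotheses (mw : measurable_fun setT w) (w_ge0 : forall x, 0 <= w x).
Hypothesis nuE : forall A, measurable A ->
  nu A = (\int[mu]_(x in D `&` phi @^-1` A) (w x)%:E)%E.

Import HBNNSimple.

Let integral_nnsfun_weighted (h : {nnsfun Y >-> R}) :
  (\int[nu]_y (h y)%:E = \int[mu]_(x in D) ((h (phi x))%:E * (w x)%:E))%E.
Proof.
rewrite integralT_nnsfun sintegralE.
pose F (k : R) (x : X) := ((k * \1_(h @^-1` [set k]) (phi x))%:E * (w x)%:E)%E.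
have mhk (k : R) : measurable (phi @^-1` (h @^-1` [set k])).
  by rewrite -[_ @^-1` _]setTI; exact: mphi.
have F0 k x : (0 <= F k x)%E.
  by rewrite mule_ge0 ?lee_fin//; exact: (nnfun_muleindic_ge0 h).
have mF k : measurable_fun D (F k).
  apply: measurable_funTS; apply: emeasurable_funM;
    apply/measurable_EFinP => //.
  apply: measurable_funM => //.
  by rewrite (_ : (fun x => _) = \1_(phi @^-1` (h @^-1` [set k]))).
have -> : (\int[mu]_(x in D) ((h (phi x))%:E * (w x)%:E) =
    \int[mu]_(x in D) \sum_(k \in range h) F k x)%E.
  apply: eq_integral => x _; rewrite {1}fimfunE -fsumEFin//.
  by rewrite ge0_mule_fsuml// => k; exact: (nnfun_muleindic_ge0 h).
rewrite ge0_integral_fsum//; apply: eq_fsbigr => k /set_mem [y _ <-{k}].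
rewrite nuE; last exact: measurable_sfunP.
rewrite integral_mkcondr -ge0_integralZl ?lee_fin//; last 2 first.
- apply/measurable_funTS/(measurable_restrictT _ (mhk _)).
  exact/measurable_funTS/measurable_EFinP.
- by move=> x _; rewrite patchE; case: ifP; rewrite ?lee_fin.
apply: eq_integral => x _; rewrite /F EFinM patchE indicE -muleA.
congr (_ * _)%E; rewrite (_ : (x \in _) = (phi x \in h @^-1` [set h y])).
  by case: ifP => _; rewrite ?mul1e ?mul0e.
by apply/idP/idP => /set_mem h1; exact/mem_set.
Qed.

Lemma ge0_integral_weighted_pushforward (f : Y -> \bar R) :
  measurable_fun setT f -> (forall y, 0 <= f y)%E ->
  (\int[nu]_y f y = \int[mu]_(x in D) (f (phi x) * (w x)%:E))%E.
Proof.
move=> mf f0; pose h := nnsfun_approx measurableT mf.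
have hf y : EFin \o h ^~ y @ \oo --> f y by exact: cvg_nnsfun_approx.
have nd_h y : {homo (fun n => (h n y)%:E) : m n / (m <= n)%N >-> (m <= n)%E}.
  by move=> m n mn; rewrite lee_fin; exact/lefP/nd_nnsfun_approx.
transitivity (limn (fun n => \int[nu]_y (h n y)%:E))%E.
  rewrite -monotone_convergence//.
  - by apply: eq_integral => y _; apply/esym/cvg_lim => //; exact: hf.
  - by move=> n; exact/measurable_EFinP/measurable_funP.
  - by move=> n y _; rewrite lee_fin.
transitivity (limn (fun n =>
    \int[mu]_(x in D) ((h n (phi x))%:E * (w x)%:E)))%E.
  by congr (limn _); apply/funext => n; exact: integral_nnsfun_weighted.
rewrite -monotone_convergence//.
- apply: eq_integral => x _; apply/cvg_lim => //.
  by apply: cvgeZr => //; exact: hf.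
- move=> n; have mh : measurable_fun setT (h n) by exact: measurable_funP.
  apply: measurable_funTS; apply: emeasurable_funM;
    apply/measurable_EFinP => //.
  exact: (measurableT_comp mh mphi).
- by move=> n x _; rewrite mule_ge0 ?lee_fin.
- move=> x _ m n mn; rewrite lee_wpmul2r ?lee_fin//.
  exact/lefP/nd_nnsfun_approx.
Qed.

Lemma integral_weighted_pushforward (f : Y -> R) : measurable_fun setT f ->
  (\int[nu]_y (f y)%:E = \int[mu]_(x in D) (f (phi x) * w x)%:E)%E.
Proof.
move=> /measurable_EFinP mf; rewrite integralE [RHS]integralE.
congr (_ - _)%E.
  rewrite ge0_integral_weighted_pushforward//; last exact: measurable_funepos.
  apply: eq_integral => x _; rewrite !funeposE EFinM.
  by rewrite maxe_pMl ?lee_fin// mul0e.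
rewrite ge0_integral_weighted_pushforward//; last exact: measurable_funeneg.
apply: eq_integral => x _; rewrite !funenegE EFinM -mulNe.
by rewrite maxe_pMl ?lee_fin// mul0e.
Qed.

End weighted_pushforward.

Section quaternion_norm.
Context {R : realType}.
Implicit Types (x y q a : quat R).

Lemma quat_sqn_ge0 x : 0 <= quat_sqn x.
Proof. by rewrite /quat_sqn !addr_ge0// sqr_ge0. Qed.

Lemma quat_absE x : quat_abs x = Num.sqrt (quat_sqn x).
Proof. by rewrite /quat_abs; congr Num.sqrt; rewrite /quat_sqn /=; ring. Qed.

Lemma sqr_quat_abs x : quat_abs x ^+ 2 = quat_sqn x.
Proof. by rewrite quat_absE sqr_sqrtr// quat_sqn_ge0. Qed.

Lemma quat_abs_gt0 x : (0 < quat_abs x) = (x != 0).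
Proof.
by rewrite quat_absE sqrtr_gt0 lt_def quat_sqn_ge0 andbT quat_sqn_eq0.
Qed.

Lemma quat_absM x y : quat_abs (x * y) = quat_abs x * quat_abs y.
Proof.
rewrite !quat_absE -sqrtrM ?quat_sqn_ge0//; congr Num.sqrt.
by rewrite /quat_sqn /=; ring.
Qed.

Lemma quat_abs_real (t : R) : quat_abs t%:H = `|t|.
Proof.
by rewrite quat_absE -sqrtr_sqr; congr Num.sqrt; rewrite /quat_sqn /=; ring.
Qed.

Lemma quat_absV x : x != 0 -> quat_abs x^-1 = (quat_abs x)^-1.
Proof.
move=> x0; have ax0 : quat_abs x != 0 by rewrite gt_eqF// quat_abs_gt0.
apply: (mulfI ax0); rewrite -quat_absM divff//.
have -> : x * x^-1 = 1%:H by exact: mulrV.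
by rewrite quat_abs_real normr1.
Qed.

Lemma ln_quat_abs x : x != 0 -> ln (quat_abs x) = 2^-1 * ln (quat_sqn x).
Proof.
move=> x0; have ax0 : 0 < quat_abs x by rewrite quat_abs_gt0.
by rewrite -sqr_quat_abs expr2 lnM ?posrE//; field.
Qed.

Lemma quat_sqn_sub x a : quat_sqn (x - a) =
  quat_sqn x + quat_sqn a - 2 * quat_dot x a.
Proof. by rewrite /quat_sqn /quat_dot /=; ring. Qed.

Lemma quat_sqn_real_sub (t : R) x a : quat_sqn (t%:H - x * qconj a) =
  t ^+ 2 + quat_sqn x * quat_sqn a - 2 * t * quat_dot x a.
Proof. by rewrite /quat_sqn /quat_dot /=; ring. Qed.

Lemma quat_sqn_sphere_poly q x : quat_sqn (sphere_poly q x) =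
  (quat_sqn x + quat_sqn q) ^+ 2
  - 4 * (quat_sqn x + quat_sqn q) * q0 x * q0 q
  + 4 * (quat_sqn q * q0 x ^+ 2 + q0 q ^+ 2 * quat_sqn x
         - quat_sqn q * quat_sqn x).
Proof. by rewrite /sphere_poly expr2 /quat_sqn /=; ring. Qed.

Lemma quat_sqn_sphere_param r (u : R * R * R) :
  quat_sqn (sphere_param r u) = r ^+ 2.
Proof.
have c1 := cos2Dsin2 u.1.1; have c2 := cos2Dsin2 u.1.2.
have c3 := cos2Dsin2 u.2.
transitivity (r ^+ 2 * (cos u.1.1 ^+ 2 + sin u.1.1 ^+ 2 * (cos u.1.2 ^+ 2
  + sin u.1.2 ^+ 2 * (cos u.2 ^+ 2 + sin u.2 ^+ 2)))).
  by rewrite /quat_sqn /=; ring.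
by rewrite c3 mulr1 c2 mulr1 c1 mulr1.
Qed.

Lemma measurable_quat (p : quat R -> R) :
  measurable_fun setT (p \o @quat_of_coords R) -> measurable_fun setT p.
Proof.
move=> mp _ A mA; rewrite setTI; have := mp measurableT _ mA.
by rewrite setTI.
Qed.

Lemma measurable_q0 : measurable_fun setT (@q0 R).
Proof.
apply: measurable_quat; do 2 apply: (measurableT_comp measurable_fst).
exact: measurable_fst.
Qed.

Lemma measurable_q1 : measurable_fun setT (@q1 R).
Proof.
apply: measurable_quat; apply: (measurableT_comp measurable_snd).
by apply: (measurableT_comp measurable_fst); exact: measurable_fst.
Qed.

Lemma measurable_q2 : measurable_fun setT (@q2 R).
Proof.
apply: measurable_quat; apply: (measurableT_comp measurable_snd).
exact: measurable_fst.
Qed.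

Lemma measurable_q3 : measurable_fun setT (@q3 R).
Proof. by apply: measurable_quat; exact: measurable_snd. Qed.

Lemma measurable_quat_dot a : measurable_fun setT (quat_dot ^~ a).
Proof.
rewrite /quat_dot; repeat apply: measurable_funD;
  apply: measurable_funM => //.
- exact: measurable_q0.
- exact: measurable_q1.
- exact: measurable_q2.
- exact: measurable_q3.
Qed.

Lemma measurable_quat_sphere r : measurable (quat_sphere r : set (quat R)).
Proof.
have m : measurable_fun setT (@quat_abs R).
  have -> : @quat_abs R = Num.sqrt \o (fun x => quat_dot x x).
    by apply/funext => x; rewrite quat_absE.
  apply: measurableT_comp.
    by apply: continuous_measurable_fun; exact: sqrt_continuous.
  rewrite /quat_dot; repeat apply: measurable_funD; apply: measurable_funM;
    exact: measurable_q0 || exact: measurable_q1 ||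
    exact: measurable_q2 || exact: measurable_q3.
have := m measurableT _ (measurable_set1 r); rewrite setTI.
by congr measurable.
Qed.

End quaternion_norm.

Section sphere_mean.
Context {R : realType}.
Local Notation mu := (@lebesgue_measure R).
Local Notation mu3 := (sigma_finite_prod mu mu \x mu)%E.

Lemma quat_sphere_param (r : R) u : 0 <= r -> quat_sphere r (sphere_param r u).
Proof.
move=> r0; rewrite /quat_sphere /= quat_absE quat_sqn_sphere_param.
by rewrite sqrtr_sqr ger0_norm.
Qed.

Lemma sphere_area_density_box (r : R) u : 0 <= r -> sphere_box u ->
  sphere_area_density r u = r ^+ 3 * box_weight u.
Proof.
move=> r0 bu; rewrite sphere_area_densityE ger0_norm// mulr_ge0//.
  exact: exprn_ge0.
exact: box_weight_ge0.
Qed.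

Lemma integral_sphere_measure (r : R) (g : quat R -> R) : 0 <= r ->
  measurable_fun setT g ->
  bounded_measurable (fun u => g (sphere_param r u)) ->
  (\int[sphere_measure r]_(y in quat_sphere r) (g y)%:E =
   (r ^+ 3 * sphere_integral (fun u => g (sphere_param r u)))%:E)%E.
Proof.
move=> r0 mg bg.
have mS := @measurable_quat_sphere R r.
rewrite integral_mkcond restrict_EFin.
have mgS : measurable_fun setT (g \_ (quat_sphere r)).
  by apply/(measurable_restrictT _ mS); exact: measurable_funTS.
rewrite (@integral_weighted_pushforward _ _ _ _ R mu3 (sphere_measure r)
  (sphere_param r) sphere_box (sphere_area_density r)).
- transitivity (\int[mu3]_(u in sphere_box)
      (g (sphere_param r u) * (r ^+ 3 * box_weight u))%:E)%E.
    apply: eq_integral => u /set_mem bu; rewrite sphere_area_density_box//.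
    by rewrite patchE mem_set//; exact: quat_sphere_param.
  have bgw : bounded_measurable
      (fun u => g (sphere_param r u) * (r ^+ 3 * box_weight u)).
    apply: bounded_measurableM => //; apply: bounded_measurableM.
      exact: bounded_measurable_cst.
    exact: bounded_measurable_weight.
  have ibgw := bounded_measurable_box_integrable bgw.
  rewrite -[LHS]fineK; last first.
    by apply: (integrable_fin_num _ ibgw); exact: measurable_sphere_box.
  congr EFin; rewrite -sphere_integralZ//; congr fine.
  by apply: eq_integral => u _; congr EFin; ring.
- exact: measurable_sphere_param.
- exact: measurable_sphere_box.
- exact: measurable_sphere_area_density.
- by move=> u; exact: sqrtr_ge0.
- by [].
- exact: mgS.
Qed.

Lemma sphere_measure_sphere (r : R) : 0 <= r ->
  sphere_measure r (quat_sphere r) = (2 * pi ^+ 2 * r ^+ 3)%:E.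
Proof.
move=> r0; have := @integral_sphere_measure r (fun=> 1) r0.
rewrite sphere_integral1 integral_cst; last exact: measurable_quat_sphere.
rewrite mul1e mulrC; apply; last exact: bounded_measurable_cst.
exact: measurable_cst.
Qed.

Lemma sphere_mean_ln (r c : R) (g : quat R -> R) (F1 F2 : R * R * R -> R) :
  0 < r -> measurable_fun setT g ->
  bounded_measurable F1 -> bounded_measurable F2 ->
  (forall u, g (sphere_param r u) = c + 2^-1 * (F1 u - F2 u)) ->
  (((fine (sphere_measure r (quat_sphere r)))^-1)%:E *
     \int[sphere_measure r]_(y in quat_sphere r) (g y)%:E =
   (c + 4^-1 * (sphere_integral F1 - sphere_integral F2) / pi ^+ 2)%:E)%E.
Proof.
move=> r0 mg b1 b2 gE.
have bN2 : bounded_measurable (fun u => -1 * F2 u).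
  by apply: bounded_measurableM => //; exact: bounded_measurable_cst.
have bB : bounded_measurable (fun u => F1 u + -1 * F2 u).
  exact: bounded_measurableD.
have bZ : bounded_measurable (fun u => 2^-1 * (F1 u + -1 * F2 u)).
  by apply: bounded_measurableM => //; exact: bounded_measurable_cst.
have b1' : bounded_measurable (fun _ : R * R * R => 1 : R).
  exact: bounded_measurable_cst.
have bc : bounded_measurable (fun _ : R * R * R => c * 1).
  exact: bounded_measurable_cst.
have gE' : (fun u => g (sphere_param r u)) =
    (fun u => c * 1 + 2^-1 * (F1 u + -1 * F2 u)).
  by apply/funext => u; rewrite gE mulr1 mulN1r.
rewrite integral_sphere_measure ?(ltW r0)//; last first.
  by rewrite gE'; exact: bounded_measurableD.
rewrite sphere_measure_sphere ?(ltW r0)// -EFinM; congr EFin => /=.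
rewrite gE' sphere_integralD// !sphere_integralZ// sphere_integralD//.
rewrite sphere_integralZ// sphere_integral1.
have pi0 : (pi : R) != 0 by rewrite gt_eqF ?pi_gt0.
have rn0 : r != 0 by rewrite gt_eqF.
by move: (pi : R) pi0 => P P0; field; rewrite ?P0 ?rn0.
Qed.

End sphere_mean.

Section blaschke_means.
Context {R : realType}.
Implicit Types (a q x y : quat R) (r s t rho : R).

Lemma sqr_quat_dot_le x y : quat_dot x y ^+ 2 <= quat_sqn x * quat_sqn y.
Proof.
have -> : quat_sqn x * quat_sqn y = quat_sqn (x * qconj y).
  by rewrite /quat_sqn /=; ring.
have -> : quat_dot x y = q0 (x * qconj y) by rewrite /quat_dot /=; ring.
by rewrite /quat_sqn -!addrA lerDl !addr_ge0// sqr_ge0.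
Qed.

Lemma ln_quat_abs_factor x k d : 0 < k -> 0 < d ->
  quat_sqn x = k ^+ 2 * d -> ln (quat_abs x) = ln k + 2^-1 * ln d.
Proof.
move=> k0 d0 xE; rewrite ln_quat_abs; last first.
  by rewrite -quat_sqn_eq0 xE mulf_neq0 ?expf_neq0// gt_eqF.
by rewrite xE expr2 !lnM ?posrE ?mulr_gt0//; field.
Qed.

Lemma sphere_mean_blaschke_point a rho r : a != 0 -> 0 < rho ->
  quat_abs a < r -> rho ^+ 2 / quat_abs a < r ->
  (((fine (sphere_measure r (quat_sphere r)))^-1)%:E *
     \int[sphere_measure r]_(y in quat_sphere r)
       (ln (quat_abs (blaschke_point a rho y)))%:E =
   (ln (quat_abs a / rho)
    + 4^-1 * ((rho ^+ 4 - quat_abs a ^+ 4) / (quat_abs a ^+ 2 * r ^+ 2)))%:E)%E.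
Proof.
rewrite -quat_abs_gt0; set m := quat_abs a => m0 rho0 mr rhor.
have r0 : 0 < r by exact: lt_trans mr.
have mn0 : m != 0 by rewrite gt_eqF.
have rn0 : r != 0 by rewrite gt_eqF.
have am : quat_sqn a = m ^+ 2 by rewrite sqr_quat_abs.
pose s1 := rho ^+ 2 / m / r; pose s2 := m / r.
have s1_lt1 : 0 <= s1 < 1.
  by rewrite /s1 !divr_ge0 ?sqr_ge0 ?ltW//= ltr_pdivrMr// mul1r.
have s2_lt1 : 0 <= s2 < 1 by rewrite /s2 divr_ge0 ?ltW//= ltr_pdivrMr// mul1r.
pose e := Quat (q0 a / m) (q1 a / m) (q2 a / m) (q3 a / m).
have e1 : quat_sqn e = 1.
  transitivity (quat_sqn a / m ^+ 2); first by rewrite /quat_sqn /=; field.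
  by rewrite am divff// expf_neq0.
pose tau y := quat_dot y a / (m * r).
pose g y := ln (m / rho) +
  2^-1 * (ln (sqdist_circle s1 (tau y)) - ln (sqdist_circle s2 (tau y))).
have mln s : measurable_fun setT (fun y => ln (sqdist_circle s (tau y))).
  apply: (measurableT_comp (@measurable_ln R)).
  apply: measurable_funB => //; apply: measurable_funM => //.
  by apply: measurable_funM => //; exact: measurable_quat_dot.
have mg : measurable_fun setT g.
  apply: measurable_funD => //; apply: measurable_funM => //.
  by apply: measurable_funB; exact: mln.
have be := bounded_measurable_zonal e.
have e_le1 u := normr_zonal_le1 u e1.
have gE u : g (sphere_param r u) = ln (m / rho) + 2^-1 *
    (ln (sqdist_circle s1 (zonal e u)) - ln (sqdist_circle s2 (zonal e u))).
  have tauE : tau (sphere_param r u) = zonal e u.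
    by rewrite /tau /zonal /quat_dot /=; field; rewrite mn0.
  by rewrite /g tauE.
have lnB y : quat_sphere r y -> ln (quat_abs (blaschke_point a rho y)) = g y.
  rewrite /quat_sphere /= => yr.
  have yr2 : quat_sqn y = r ^+ 2 by rewrite -sqr_quat_abs yr.
  have tau_le1 : `|tau y| <= 1.
    rewrite -(@ler_pXn2r _ 2) ?nnegrE// expr1n real_normK ?num_real//.
    rewrite /tau expr_div_n ler_pdivrMr ?exprn_gt0 ?mulr_gt0// mul1r.
    by rewrite exprMn -am mulrC -yr2; exact: sqr_quat_dot_le.
  have D1 := sqdist_circle_gt0 s1_lt1 tau_le1.
  have D2 := sqdist_circle_gt0 s2_lt1 tau_le1.
  have numE : quat_sqn ((rho ^+ 2)%:H - y * qconj a) =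
      (m * r) ^+ 2 * sqdist_circle s1 (tau y).
    rewrite quat_sqn_real_sub yr2 am /sqdist_circle /s1 /tau.
    by field; rewrite rn0 mn0.
  have denE : quat_sqn (y - a) = r ^+ 2 * sqdist_circle s2 (tau y).
    rewrite quat_sqn_sub yr2 am /sqdist_circle /s2 /tau.
    by field; rewrite rn0 mn0.
  have num_ln := ln_quat_abs_factor (mulr_gt0 m0 r0) D1 numE.
  have den_ln := ln_quat_abs_factor r0 D2 denE.
  have num0 : 0 < quat_abs ((rho ^+ 2)%:H - y * qconj a).
    rewrite quat_abs_gt0 -quat_sqn_eq0 numE gt_eqF// mulr_gt0//.
    by rewrite exprn_gt0// mulr_gt0.
  have den0 : 0 < quat_abs (y - a).
    by rewrite quat_abs_gt0 -quat_sqn_eq0 denE gt_eqF// mulr_gt0// exprn_gt0.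
  rewrite /blaschke_point quat_absM quat_absV; last first.
    by rewrite -quat_abs_gt0 quat_absM quat_abs_real gtr0_norm// mulr_gt0.
  rewrite quat_absM quat_abs_real (gtr0_norm rho0).
  rewrite ln_div ?posrE ?mulr_gt0// lnM ?posrE// num_ln den_ln.
  by rewrite lnM ?posrE// /g ln_div ?posrE//; ring.
under eq_integral => y /set_mem yS do rewrite lnB//.
rewrite (sphere_mean_ln r0 mg (bounded_measurable_ln_sqdist s1_lt1 be e_le1)
  (bounded_measurable_ln_sqdist s2_lt1 be e_le1) gE).
rewrite !sphere_integral_ln_zonal//; congr (_ + _)%:E.
have pi0 : (pi : R) != 0 by rewrite gt_eqF ?pi_gt0.
by rewrite /s1 /s2; move: (pi : R) pi0 => P P0; field; rewrite ?P0 ?rn0 ?mn0.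
Qed.

(* The squared modulus, divided by r ^+ 4, of [sphere_poly q] at a point y of
   the sphere of radius r, for s = |q| / r, x = q0 y / r and p = q0 q / |q|. *)
Definition sqmod_circle_pair (s p x : R) := (1 + s ^+ 2) ^+ 2
  - 4 * s * (1 + s ^+ 2) * x * p + 4 * s ^+ 2 * (x ^+ 2 + p ^+ 2 - 1).

Lemma sqmod_circle_pair_cos (s t theta : R) :
  sqmod_circle_pair s (cos t) (cos theta) =
  sqdist_circle s (cos (theta - t)) * sqdist_circle s (cos (theta + t)).
Proof.
apply: subr0_eq; rewrite cosB cosD.
have c1 := cos2Dsin2 t; have c2 := cos2Dsin2 theta.
transitivity (4 * s ^+ 2 *
  ((cos t ^+ 2 - 1) * (cos theta ^+ 2 + sin theta ^+ 2 - 1)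
   - sin theta ^+ 2 * (cos t ^+ 2 + sin t ^+ 2 - 1)) * -1).
  by rewrite /sqmod_circle_pair /sqdist_circle; ring.
by rewrite c1 c2; ring.
Qed.

Lemma ln_sqmod_circle_pair (s t theta : R) : 0 <= s < 1 ->
  ln (sqmod_circle_pair s (cos t) (cos theta)) =
  ln (sqdist_circle s (cos (theta - t))) +
  ln (sqdist_circle s (cos (theta + t))).
Proof.
move=> s01; rewrite sqmod_circle_pair_cos lnM// posrE sqdist_circle_gt0//;
  by rewrite ler_norml cos_geN1 cos_le1.
Qed.

Lemma sqmod_circle_pair_gt0 (s p x : R) : 0 <= s < 1 ->
  `|p| <= 1 -> `|x| <= 1 -> 0 < sqmod_circle_pair s p x.
Proof.
move=> s01 /ler_normlP[p1 p2] /ler_normlP[x1 x2].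
rewrite -[p]acosK; last by rewrite in_itv/=; apply/andP; split; lra.
rewrite -[x]acosK; last by rewrite in_itv/=; apply/andP; split; lra.
by rewrite sqmod_circle_pair_cos mulr_gt0// sqdist_circle_gt0//;
  rewrite ler_norml cos_geN1 cos_le1.
Qed.

Lemma quat_sqn_sphere_poly_circle q y r : q != 0 -> 0 < r ->
  quat_sqn y = r ^+ 2 -> quat_sqn (sphere_poly q y) =
  (r ^+ 2) ^+ 2 *
  sqmod_circle_pair (quat_abs q / r) (q0 q / quat_abs q) (q0 y / r).
Proof.
rewrite -quat_abs_gt0 => q_gt0 r0 yr.
rewrite quat_sqn_sphere_poly yr -(sqr_quat_abs q).
have qn0 : quat_abs q != 0 by rewrite gt_eqF.
have rn0 : r != 0 by rewrite gt_eqF.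
by rewrite /sqmod_circle_pair; field; rewrite ?qn0 ?rn0.
Qed.

Lemma normr_q0_le_abs x : `|q0 x| <= quat_abs x.
Proof.
rewrite quat_absE -sqrtr_sqr ler_sqrt ?quat_sqn_ge0//.
by rewrite /quat_sqn -!addrA lerDl !addr_ge0// sqr_ge0.
Qed.

Lemma sphere_mean_blaschke_sphere a rho r : a != 0 -> 0 < rho ->
  quat_abs a < r -> rho ^+ 2 / quat_abs a < r ->
  (((fine (sphere_measure r (quat_sphere r)))^-1)%:E *
     \int[sphere_measure r]_(y in quat_sphere r)
       (ln (quat_abs (blaschke_sphere a rho y)))%:E =
   (2 * ln (quat_abs a / rho)
    - 4^-1 * ((rho ^+ 4 - quat_abs a ^+ 4) / (quat_abs a ^+ 4 * r ^+ 2))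
      * (2 * quat_abs a ^+ 2 - q0 ((a + qconj a) ^+ 2)))%:E)%E.
Proof.
move=> a_neq0; have := a_neq0.
rewrite -quat_abs_gt0; set m := quat_abs a => m0 rho0 mr rhor.
have r0 : 0 < r by exact: lt_trans mr.
have mn0 : m != 0 by rewrite gt_eqF.
have rn0 : r != 0 by rewrite gt_eqF.
have am : quat_sqn a = m ^+ 2 by rewrite sqr_quat_abs.
pose s1 := rho ^+ 2 / m / r; pose s2 := m / r.
have s1_lt1 : 0 <= s1 < 1.
  by rewrite /s1 !divr_ge0 ?sqr_ge0 ?ltW//= ltr_pdivrMr// mul1r.
have s2_lt1 : 0 <= s2 < 1 by rewrite /s2 divr_ge0 ?ltW//= ltr_pdivrMr// mul1r.
pose q := (rho ^+ 2)%:H * a^-1.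
have q_abs : quat_abs q = rho ^+ 2 / m.
  by rewrite quat_absM quat_abs_real quat_absV// ger0_norm// sqr_ge0.
have q_neq0 : q != 0 by rewrite -quat_abs_gt0 q_abs divr_gt0// exprn_gt0.
pose p := q0 a / m.
have pE : q0 q / quat_abs q = p.
  have -> : q0 q = rho ^+ 2 * (q0 a / quat_sqn a) by rewrite /=; ring.
  by rewrite q_abs am /p; field; rewrite mn0 gt_eqF.
have p_le1 : `|p| <= 1.
  by rewrite normrM normfV (gtr0_norm m0) ler_pdivrMr// mul1r normr_q0_le_abs.
pose t := acos p.
have tE : cos t = p.
  move/ler_normlP : p_le1 => [p1 p2].
  by rewrite acosK// in_itv/=; apply/andP; split; lra.
pose g y := 2 * ln (m / rho) + 2^-1 * (ln (sqmod_circle_pair s1 p (q0 y / r))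
  - ln (sqmod_circle_pair s2 p (q0 y / r))).
have mln s :
    measurable_fun setT (fun y => ln (sqmod_circle_pair s p (q0 y / r))).
  apply: (measurableT_comp (@measurable_ln R)).
  have mq : measurable_fun setT (fun y : quat R => q0 y / r).
    by apply: measurable_funM => //; exact: measurable_q0.
  rewrite /sqmod_circle_pair; apply: measurable_funD.
    apply: measurable_funB => //; apply: measurable_funM => //.
    exact: measurable_funM.
  apply: measurable_funM => //; apply: measurable_funB => //.
  by apply: measurable_funD => //; exact: measurable_funX.
have mg : measurable_fun setT g.
  apply: measurable_funD => //; apply: measurable_funM => //.
  by apply: measurable_funB; exact: mln.
pose F s (u : R * R * R) := ln (sqdist_circle s (cos (u.1.1 - t)))
  + ln (sqdist_circle s (cos (u.1.1 + t))).
have bl s k : 0 <= s < 1 -> bounded_measurable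
    (fun u : R * R * R => ln (sqdist_circle s (cos (u.1.1 + k)))).
  move=> s01; apply: bounded_measurable_ln_sqdist => //.
    apply: bounded_measurable_cos; apply: measurable_funD => //.
    exact: measurable_angle1.
  by move=> u; rewrite ler_norml cos_geN1 cos_le1.
have bF s : 0 <= s < 1 -> bounded_measurable (F s).
  by move=> s01; apply: bounded_measurableD; exact: bl.
have gE u : g (sphere_param r u) = 2 * ln (m / rho) + 2^-1 * (F s1 u - F s2 u).
  have -> : g (sphere_param r u) = 2 * ln (m / rho) + 2^-1 *
      (ln (sqmod_circle_pair s1 p (cos u.1.1))
       - ln (sqmod_circle_pair s2 p (cos u.1.1))).
    by rewrite /g /= mulrAC mulfV// mul1r.
  by rewrite -tE !ln_sqmod_circle_pair.
have lnB y : quat_sphere r y -> ln (quat_abs (blaschke_sphere a rho y)) = g y.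
  rewrite /quat_sphere /= => yr.
  have yr2 : quat_sqn y = r ^+ 2 by rewrite -sqr_quat_abs yr.
  have y_le1 : `|q0 y / r| <= 1.
    rewrite normrM normfV (gtr0_norm r0) ler_pdivrMr// mul1r -yr.
    exact: normr_q0_le_abs.
  have D1 := sqmod_circle_pair_gt0 s1_lt1 p_le1 y_le1.
  have D2 := sqmod_circle_pair_gt0 s2_lt1 p_le1 y_le1.
  have r2 : 0 < r ^+ 2 by exact: exprn_gt0.
  have numE := quat_sqn_sphere_poly_circle q_neq0 r0 yr2.
  rewrite pE q_abs -/s1 in numE.
  have denE := quat_sqn_sphere_poly_circle a_neq0 r0 yr2.
  rewrite -/m -/p -/s2 in denE.
  have num_ln := ln_quat_abs_factor r2 D1 numE.
  have den_ln := ln_quat_abs_factor r2 D2 denE.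
  have num0 : 0 < quat_abs (sphere_poly q y).
    by rewrite quat_abs_gt0 -quat_sqn_eq0 numE gt_eqF// mulr_gt0// exprn_gt0.
  have den0 : 0 < quat_abs (sphere_poly a y).
    by rewrite quat_abs_gt0 -quat_sqn_eq0 denE gt_eqF// mulr_gt0// exprn_gt0.
  have rho2 : 0 < rho ^+ 2 by exact: exprn_gt0.
  have m2 : 0 < m ^+ 2 by exact: exprn_gt0.
  rewrite /blaschke_sphere -/q -/m !quat_absM quat_absV; last first.
    by rewrite -quat_abs_gt0 quat_absM quat_abs_real gtr0_norm// mulr_gt0.
  rewrite quat_absM !quat_abs_real !gtr0_norm//.
  rewrite lnM ?posrE ?mulr_gt0 ?invr_gt0 ?mulr_gt0//.
  rewrite lnM ?posrE ?invr_gt0 ?mulr_gt0// lnV ?posrE ?mulr_gt0//.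
  rewrite lnM ?posrE// num_ln den_ln /g ln_div ?posrE//.
  by rewrite [rho ^+ 2]expr2 [m ^+ 2]expr2 !lnM ?posrE//; ring.
under eq_integral => y /set_mem yS do rewrite lnB//.
rewrite (sphere_mean_ln r0 mg (bF _ s1_lt1) (bF _ s2_lt1) gE).
rewrite /F !sphere_integralD; [|exact: bl..].
rewrite !sphere_integral_ln_cos_pair//; congr EFin.
have -> : cos (2 * t) = 2 * p ^+ 2 - 1.
  by rewrite mulr_natl cos_mulr2n tE mulr_natl.
have -> : q0 ((a + qconj a) ^+ 2) = 4 * (q0 a) ^+ 2 by rewrite expr2 /=; ring.
have pi0 : (pi : R) != 0 by rewrite gt_eqF ?pi_gt0.
by rewrite /s1 /s2 /p; move: (pi : R) pi0 => P P0; field; rewrite ?P0 ?rn0 ?mn0.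
Qed.

End blaschke_means.

Unset Implicit Arguments.

Theorem corollary3p14 (R : realType) (a : quat R) (rho r : R) :
  a != 0 -> 0 < rho ->
  Num.max (quat_abs a) (rho ^+ 2 * (quat_abs a)^-1) < r ->
  (((fine (sphere_measure r (quat_sphere r)))^-1)%:E *
     \int[sphere_measure r]_(y in quat_sphere r)
       (ln (quat_abs (blaschke_point a rho y)))%:E =
   (ln (quat_abs a / rho)
    + 4^-1 * ((rho ^+ 4 - quat_abs a ^+ 4) / (quat_abs a ^+ 2 * r ^+ 2)))%:E)%E
  /\
  (((fine (sphere_measure r (quat_sphere r)))^-1)%:E *
     \int[sphere_measure r]_(y in quat_sphere r)
       (ln (quat_abs (blaschke_sphere a rho y)))%:E =
   (2 * ln (quat_abs a / rho)
    - 4^-1 * ((rho ^+ 4 - quat_abs a ^+ 4) / (quat_abs a ^+ 4 * r ^+ 2))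
      * (2 * quat_abs a ^+ 2 - q0 ((a + qconj a) ^+ 2)))%:E)%E.
Proof.
move=> a0 rho0; rewrite gt_max => /andP[ar rhor].
split; first exact: sphere_mean_blaschke_point.
exact: sphere_mean_blaschke_sphere.
Qed.
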